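(* There exists a function $r\colon(0,1)\to(-1,\infty)$ with $r(\epsilon)\to0$ as $\epsilon\to0$ such that the following holds. Let $d\ge 1$ and $n\ge 1$ be integers, let $\epsilon\in(0,1)$, and let $\beta\in(0,\infty]$ satisfy $\beta\ge 4\sqrt{2/\pi}/\epsilon$. Suppose $\hat\theta\colon(\mathbb{R}^d\times\{-1,1\})^n\to S^{d-1}$ is an estimator such that, for every $\theta^\star\in S^{d-1}$, $$\Pr\big(\|\hat\theta((\mathbf{x}_i,\mathbf{y}_i)_{i=1}^n)-\theta^\star\|<\epsilon\big)\ge\tfrac12,$$ where the probability is over i.i.d. data $(\mathbf{x}_1,\mathbf{y}_1),\dots,(\mathbf{x}_n,\mathbf{y}_n)$ drawn from the logistic regression model with parameter $\theta^\star$ and inverse temperature $\beta$. Then $$n\ \ge\ \frac{d-1}{\epsilon}\cdot\frac{\log(\log(2e/\epsilon))-\log(16e)}{(1+r(\epsilon))\,\log(2e/\epsilon)}.$$ Moreover, if $\beta=\infty$, then in fact $n\ge (d-1)/(8e\epsilon)$.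
   Context: $\|\cdot\|$ is the Euclidean norm on $\mathbb{R}^d$, $S^{d-1}=\{\theta\in\mathbb{R}^d:\|\theta\|=1\}$, and $\log$ is the natural logarithm. Logistic regression model with parameter $\theta\in S^{d-1}$ and inverse temperature $\beta$: $\mathbf{x}\sim N(0,I_d)$ is a standard normal vector in $\mathbb{R}^d$ and, conditionally on $\mathbf{x}$, $\mathbf{y}\in\{-1,1\}$ equals $1$ with probability $g'(\beta\,\mathbf{x}^{\top}\theta)$, where $g'(\eta)=1/(1+e^{-\eta})$. For $\beta=\infty$, the response is deterministic given $\mathbf{x}$: $\mathbf{y}=1$ if $\mathbf{x}^{\top}\theta>0$ and $\mathbf{y}=-1$ otherwise. An estimator is a measurable map from the data space to $S^{d-1}$ (it may depend on $\beta$, $d$, $n$, $\epsilon$). The function $r$ depends on nothing but $\epsilon$. *)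

(* Defs.v *)
From HB Require Import structures.
From mathcomp Require Import all_boot all_order all_algebra.
From mathcomp Require Import all_classical all_reals all_analysis.
From mathcomp Require Import measurable_realfun.

Set Implicit Arguments.
Unset Strict Implicit.
Unset Printing Implicit Defensive.

Import Order.TTheory GRing.Theory Num.Theory.
Import numFieldNormedType.Exports.

Local Open Scope classical_set_scope.
Local Open Scope ring_scope.

Section euclidean.
Context {R : realType} {d : nat}.
Implicit Types x y : d.-tuple R.

Definition dotp x y : R := \sum_(i < d) tnth x i * tnth y i.

Definition enorm x : R := Num.sqrt (dotp x x).

Definition tsub x y : d.-tuple R := [tuple tnth x i - tnth y i | i < d].

Definition unit_sphere : set (d.-tuple R) := [set x | enorm x = 1].

Lemma measurable_dotp y : measurable_fun [set: d.-tuple R] (dotp ^~ y).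
Proof.
apply: measurable_sum => i; apply: measurable_funM => //.
exact: measurable_tnth.
Qed.

End euclidean.
Arguments unit_sphere {R} d.

Section iid.
Context {dT : measure_display} {T : measurableType dT} {R : realType}.

Definition tcons n (z : T * n.-tuple T) : n.+1.-tuple T :=
  [tuple of z.1 :: z.2].

Lemma measurable_tcons n : measurable_fun [set: T * n.-tuple T] (@tcons n).
Proof. exact: measurable_cons. Qed.

HB.instance Definition _ n :=
  isMeasurableFun.Build _ _ _ _ (@tcons n) (@measurable_tcons n).

Variable P : probability T R.

(* law of n independent draws from P *)
Fixpoint iid_law n : probability (n.-tuple T) R :=
  match n with
  | 0 => \d_([tuple])
  | m.+1 => distribution (P \x iid_law m)%E (@tcons m)
  end.

Lemma iid_law_box n (A : 'I_n -> set T) :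
  (forall i, measurable (A i)) ->
  iid_law n [set t | forall i, A i (tnth t i)] = (\prod_(i < n) P (A i))%E.
Proof.
elim: n A => [|n IH] A mA.
  by rewrite big_ord0 /= diracE mem_set// => -[].
rewrite big_ord_recl /= /distribution /pushforward.
have mB : measurable [set t : n.-tuple T | forall i, A (lift ord0 i) (tnth t i)].
  rewrite (_ : [set _ | _] =
    \bigcap_(i in [set: 'I_n]) ((@tnth n T ^~ i) @^-1` A (lift ord0 i))).
    apply: fin_bigcap_measurable => // i _; rewrite -[X in measurable X]setTI.
    exact: measurable_tnth.
  by apply/seteqP; split => t /= h i; [move=> _|]; exact: h.
rewrite (_ : _ @^-1` _ =
  A ord0 `*` [set t : n.-tuple T | forall i, A (lift ord0 i) (tnth t i)]).
  rewrite product_measure1E//; congr (_ * _)%E; exact: IH.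
apply/seteqP; split => -[x t] /=.
  move=> h; split; first exact: (h ord0).
  by move=> i; have := h (lift ord0 i); rewrite /tcons tnthS.
move=> [h0 h] i; have [->//|i0] := eqVneq i ord0.
by case: (unliftP ord0 i) i0 => [j ->|->]; rewrite ?eqxx// /tcons tnthS.
Qed.

End iid.

Section std_normal.
Context {R : realType}.

(* [normal_prob] lives on [measurableTypeR R], whose measurable sets are the
   same as those of [R] but which has a different display. *)
Definition to_R : measurableTypeR R -> R := idfun.

Lemma measurable_to_R : measurable_fun [set: measurableTypeR R] to_R.
Proof. exact: measurable_id. Qed.

HB.instance Definition _ :=
  isMeasurableFun.Build _ _ _ _ to_R measurable_to_R.

Definition std_normal1 : probability R R :=
  distribution (normal_prob (0 : R) 1) to_R.

(* N(0, I_d): the coordinates are i.i.d. N(0, 1) *)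
Definition std_normal d : probability (d.-tuple R) R := iid_law std_normal1 d.

End std_normal.

Section logistic_model.
Context {R : realType}.

(* Labels are booleans, [true] standing for the response 1 and [false] for -1.
   The value at -oo is a placeholder. *)
Definition response_prob (beta : \bar R) (eta : R) : R :=
  match beta with
  | b%:E => (1 + expR (- (b * eta)))^-1
  | +oo%E => if 0 < eta then 1 else 0
  | -oo%E => 0
  end.

Lemma response_prob01 beta eta : 0 <= response_prob beta eta <= 1.
Proof.
case: beta => [b| |] /=; last by rewrite lexx ler01.
- have e0 := expR_gt0 (- (b * eta)).
  rewrite invr_ge0 invf_le1 ?addr_gt0// lerDl (ltW e0) andbT.
  by rewrite addr_ge0 // ltW.
- by case: ifPn => _; rewrite ?lexx ler01.
Qed.

Lemma measurable_response_prob beta :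
  measurable_fun [set: R] (response_prob beta).
Proof.
case: beta => [b| |] /=.
- apply: continuous_measurable_fun => x.
  have e0 := expR_gt0 (- (b * x)).
  apply: cvgV; first by rewrite gt_eqF// addr_gt0.
  apply: cvgD; first exact: cvg_cst.
  apply: (@continuous_comp _ _ _ (fun t => - (b * t)) expR).
    by apply: cvgN; apply: cvgM; [exact: cvg_cst|exact: cvg_id].
  exact: continuous_expR.
- by apply: measurable_fun_if => //=; exact: measurable_fun_ltr.
- exact: measurable_cst.
Qed.

Variables (d : nat) (beta : \bar R) (theta : d.-tuple R).

Definition label_law (x : d.-tuple R) : probability bool R :=
  bernoulli_prob (response_prob beta (dotp x theta)).

Definition logistic_law (A : set (d.-tuple R * bool)) : \bar R :=
  (\int[std_normal d]_x label_law x (xsection A x))%E.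

Let measurable_label A : measurable A ->
  measurable_fun [set: d.-tuple R] (fun x => label_law x (xsection A x)).
Proof.
move=> mA; pose p x := response_prob beta (dotp x theta).
have mp : measurable_fun [set: d.-tuple R] p.
  exact: (measurableT_comp (measurable_response_prob beta)
                           (measurable_dotp theta)).
have mI b : measurable_fun [set: d.-tuple R] (fun x => \1_A (x, b) : R).
  apply: (@measurableT_comp _ _ _ _ _ _ (\1_A : _ -> R) _ (pair^~ b)).
    exact: measurable_indic.
  exact: pair2_measurable.
rewrite (_ : (fun x => _) = fun x =>
    (p x * \1_A (x, true) + (1 - p x) * \1_A (x, false))%:E).
  apply/measurable_EFinP; apply: measurable_funD; apply: measurable_funM => //.
  exact: measurable_funB.
apply/funext => x; rewrite /label_law/= bernoulli_probE ?response_prob01//.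
by rewrite !diracE !indicE !mem_xsection -!EFinM -EFinD.
Qed.

Let logistic0 : logistic_law set0 = 0%E.
Proof. by rewrite [LHS]integral0_eq// => x _; rewrite xsection0 measure0. Qed.

Let logistic_ge0 A : (0 <= logistic_law A)%E.
Proof. by apply: integral_ge0 => x _; exact: measure_ge0. Qed.

Let logistic_sigma_additive : semi_sigma_additive logistic_law.
Proof.
move=> F mF tF mUF.
rewrite [X in _ --> X](_ : _ = \sum_(n <oo) logistic_law (F n))%E.
  by apply/cvg_closeP; split; [exact: is_cvg_nneseries|rewrite closeE].
rewrite -integral_nneseries//; last by move=> n; exact: measurable_label.
apply: eq_integral => x _; apply/esym/cvg_lim => //=; rewrite xsection_bigcup.
apply: (measure_sigma_additive _ (trivIset_xsection tF)) => ?.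
exact: measurable_xsection.
Qed.

HB.instance Definition _ := isMeasure.Build _ _ _ logistic_law
  logistic0 logistic_ge0 logistic_sigma_additive.

Let logistic_setT : logistic_law setT = 1%E.
Proof.
rewrite /logistic_law (eq_integral (cst 1%E)); last first.
  move=> x _; rewrite xsectionE preimage_setT.
  exact: (probability_setT (label_law x)).
by rewrite integral_cst// mul1e; exact: (probability_setT (std_normal d)).
Qed.

HB.instance Definition _ := Measure_isProbability.Build _ _ _ logistic_law
  logistic_setT.

Definition data_law n : probability (n.-tuple (d.-tuple R * bool)) R :=
  iid_law logistic_law n.

End logistic_model.

(* Main.v *)
From HB Require Import structures.
Require Import Defs.
From mathcomp Require Import all_boot all_order all_algebra.
From mathcomp Require Import all_classical all_reals all_analysis.
From mathcomp Require Import measurable_realfun ring lra.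

Import Order.TTheory GRing.Theory Num.Theory.
Import numFieldNormedType.Exports.

(** The parameter is hidden among finitely many well separated ones, and the
    labels carry too little information to tell these apart: the proof counts
    labelings.

    Fix the points of the sample.  The estimator only sees the [n] labels, so it
    takes at most one value per labeling, and each value is within [eps] of at
    most one element of a 2 [eps]-separated family of parameters.  Hence the
    probabilities of success, summed over the family, are at most the number of
    labelings that can occur ([success_counting]); as each is at least 1/2, this
    bounds the size of the family.  No conditional law is needed for this, only
    that a labeling has conditional probability at most 1
    ([iid_law_le_sum_attach]).

    Write d = m + 1.  A separated family of about (c / eps) ^ m parameters comes
    from a packing of a ball of R^m ([exists_separated]), lifted to the sphere
    near the first basis vector.  On the other side, halfspaces whose normal
    vector has a positive first coordinate label [n] points in at most
    (e n / m) ^ m ways ([card_sign_patterns_le]).  Without noise these are all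
    the labelings that occur, and comparing the two powers gives n >= c m / eps
    ([samples_ge_noiseless]).  The argument needs m <= n and [eps] small; for
    larger [eps] the family is replaced by the vertices of a cube, of which a
    ball of radius [eps] contains an exponentially small fraction, and the
    number of labelings by 2 ^ n ([samples_ge_of_large_eps]).

    At finite temperature a label disagrees with the sign of x^T theta with
    probability O(1 / beta), because the density of x^T theta is bounded
    ([logistic_mislabeled_le]).  The condition on [beta] makes this less than
    eps / 3, so that with probability at least 11/16 at most [n eps]
    labels are wrong.  The labelings are then those at Hamming distance at most
    [n eps] from a sign pattern, which costs a factor (e / eps) ^ (n eps).  With
    a = n eps / m the comparison becomes 1 <= C a (e / eps) ^ a
    ([samples_ge_noisy]), and solving it for [a] yields the quotient of
    log log (2 e / eps) - log (16 e) and log (2 e / eps), up to a factor that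
    tends to 1 ([log_rate_le]). *)

Local Open Scope ring_scope.

(** * Sign patterns of vectors on points *)

Lemma sum_bin_S (n r : nat) :
  (\sum_(k < r.+1) 'C(n.+1, k) =
   \sum_(k < r.+1) 'C(n, k) + \sum_(k < r) 'C(n, k))%N.
Proof.
rewrite big_ord_recl [in RHS]big_ord_recl !bin0 -addnA; congr addn.
by rewrite -big_split; apply: eq_bigr => i _ /=; rewrite binS.
Qed.

Lemma card_tuple_boolS (n : nat) (S : {set n.+1.-tuple bool}) :
  let ext b := [set t : n.-tuple bool | [tuple of b :: t] \in S] in
  #|S| = (#|ext true| + #|ext false|)%N.
Proof.
move=> ext.
have inj b : injective (fun t : n.-tuple bool => [tuple of b :: t]).
  by move=> s t /(congr1 val) /= [] /val_inj.
rewrite -(card_imset (mem (ext true)) (inj true)).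
rewrite -(card_imset (mem (ext false)) (inj false)) -cardsUI.
rewrite (_ : _ :&: _ = finset.set0) ?cards0 ?addn0; last first.
  apply/setP => s; rewrite !inE; apply/negP => /andP[/imsetP[t _ ->]].
  by case/imsetP=> u _ /(congr1 val).
congr #|pred_of_set _|; apply/setP => s; rewrite !inE.
apply/idP/orP => [|[] /imsetP[t]]; last 2 first.
- by rewrite inE => tS ->.
- by rewrite inE => tS ->.
case/tupleP: s => b t sS.
by case: b sS => sS; [left|right]; apply/imsetP; exists t; rewrite ?inE.
Qed.

(** Cover's count of sign patterns, for vectors [w] of the subspace [V] in the
    half-space where [e] is positive.  This half-space is an affine space of
    dimension \rank V - 1 up to scaling, so the bound is the number of cells of
    an arrangement of [n] hyperplanes in that dimension.  The recursion is the
    usual one: a pattern of the other points extends in both ways to one more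
    point only if it is realized on the hyperplane of that point, which lowers
    the rank by one.  Asking for [e] positive, rather than for all patterns of
    [V], is what brings the exponent down from the dimension of the space to
    that of the sphere. *)
Lemma card_sign_patterns_le (F : realFieldType) (d n : nat)
    (x : 'I_n -> 'cV[F]_d) (e : 'cV[F]_d) (V : 'M[F]_d)
    (S : {set n.-tuple bool}) :
  (forall s, s \in S -> exists2 w : 'rV[F]_d,
     (w <= V)%MS && (0 < (w *m e) 0 0) &
     forall i, tnth s i = (0 < (w *m x i) 0 0)) ->
  (#|S| <= \sum_(k < \rank V) 'C(n, k))%N.
Proof.
elim: n x V S => [|n IH] x V S HS.
  have [->|[s sS]] := set_0Vmem S; first by rewrite cards0.
  have [w /andP[wV we] _] := HS _ sS.
  case r0 : (\rank V) => [|r].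
    move/eqP: r0; rewrite mxrank_eq0 => /eqP V0.
    by move: wV we; rewrite V0 submx0 => /eqP ->; rewrite mul0mx mxE ltxx.
  rewrite big_ord_recl bin0; apply: leq_trans (leq_addr _ _).
  by apply: leq_trans (max_card _) _; rewrite card_tuple expn0.
set ext := fun b => [set t : n.-tuple bool | [tuple of b :: t] \in S].
have extP b t : t \in ext b -> exists2 w : 'rV[F]_d,
    (w <= V)%MS && (0 < (w *m e) 0 0) &
    (0 < (w *m x ord0) 0 0) = b /\
    forall i, tnth t i = (0 < (w *m x (lift ord0 i)) 0 0).
  rewrite inE => /HS[w wV wx]; exists w => //; split.
    by rewrite -wx.
  by move=> i; rewrite -wx tnthS.
have HU : (#|ext true :|: ext false| <= \sum_(k < \rank V) 'C(n, k))%N.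
  apply: (IH (fun i => x (lift ord0 i))) => s /setUP[] /extP[w wV [_ wx]];
  by exists w.
have HI : (#|ext true :&: ext false| <= \sum_(k < (\rank V).-1) 'C(n, k))%N.
  have [->|[s0 s0I]] := set_0Vmem (ext true :&: ext false).
    by rewrite cards0.
  set W := (V :&: kermx (x ord0))%MS.
  have rW : (\rank W <= (\rank V).-1)%N.
    have := mxrank_mul_ker V (x ord0); rewrite -/W => <-.
    have [/extP[w /andP[wV _] [wx _]] _] := setIP s0I.
    suff : (0 < \rank (V *m x ord0))%N.
      by case: (\rank _) => // r _; rewrite addSn /= leq_addl.
    rewrite lt0n mxrank_eq0; apply: contraTneq wx => V0.
    by case/submxP: wV => u ->; rewrite -mulmxA V0 mulmx0 mxE ltxx.
  apply: leq_trans (_ : \sum_(k < \rank W) 'C(n, k) <= _)%N; last first.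
    by rewrite -(subnK rW) addnC big_split_ord leq_addr.
  apply: (IH (fun i => x (lift ord0 i))) => s /setIP[].
  move=> /extP[u /andP[uV ue] [ux us]] /extP[v /andP[vV ve] [vx vs]].
  (* The two vectors have opposite signs on x ord0, so some positive
     combination of them vanishes there; it keeps the common signs. *)
  set a := (u *m x ord0) 0 0 in ux; set b := (v *m x ord0) 0 0 in vx.
  have b0 : 0 <= - b by move/negbT: vx; rewrite -leNgt oppr_ge0.
  have combE (c : 'cV[F]_d) : ((- b *: u + a *: v) *m c) 0 0 =
      - b * (u *m c) 0 0 + a * (v *m c) 0 0.
    rewrite mulmxDl -!scalemxAl [LHS]mxE.
    by rewrite [X in X + _]mxE [X in _ + X]mxE.
  exists (- b *: u + a *: v).
    rewrite sub_capmx addmx_sub ?scalemx_sub//=.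
    apply/andP; split; last first.
      rewrite combE.
      by apply: ltr_wpDl; [apply: mulr_ge0 => //; exact: ltW|exact: mulr_gt0].
    apply/sub_kermxP/matrixP => i j; rewrite !ord1 combE [RHS]mxE.
    by rewrite -/a -/b; ring.
  move=> i; rewrite combE.
  move: (us i) (vs i); set p := (u *m _) 0 0; set q := (v *m _) 0 0.
  case: (tnth s i) => /esym p0 /esym q0; apply/esym.
    by apply: ltr_wpDl; [apply: mulr_ge0 => //; exact: ltW|exact: mulr_gt0].
  apply/negbTE; rewrite -leNgt; move/negbT: p0; move/negbT: q0.
  rewrite -!leNgt => q0 p0.
  by rewrite -[leRHS](addr0 0) lerD // ?mulr_ge0_le0 // ltW.
case r0 : (\rank V) HU HI => [|r] HU HI.
  rewrite big_ord0 leqn0 cards_eq0; apply/eqP/setP => s; rewrite inE.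
  apply/negP => /HS[w /andP[wV we] _].
  move/eqP: r0; rewrite mxrank_eq0 => /eqP V0.
  by move: wV we; rewrite V0 submx0 => /eqP ->; rewrite mul0mx mxE ltxx.
rewrite card_tuple_boolS -/(ext true) -/(ext false) -cardsUI sum_bin_S.
exact: leq_add.
Qed.

(** * Binomial sums and Hamming balls *)

(** Each of the first binomial coefficients is weighted in (1 + x) ^+ n by at
    least x ^+ k. *)
Lemma sum_bin_le_expR (R : realType) (n k : nat) (x : R) : 0 <= x <= 1 ->
  (\sum_(j < k.+1) 'C(n, j))%:R * x ^+ k <= expR (n%:R * x).
Proof.
move=> /andP[x0 x1].
have le1 : (1 + x) ^+ n <= expR (n%:R * x).
  rewrite mulrC expRM_natr lerXn2r ?nnegrE ?addr_ge0 ?expR_ge0//.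
  exact: expR_ge1Dx.
apply: le_trans le1; rewrite exprDn natr_sum mulr_suml.
rewrite -(big_mkord xpredT (fun j => 'C(n, j)%:R * x ^+ k)).
rewrite -(big_mkord xpredT (fun j => (1 ^+ (n - j) * x ^+ j) *+ 'C(n, j))).
apply: (@le_trans _ _ (\sum_(0 <= j < k.+1) (1 ^+ (n - j) * x ^+ j) *+ 'C(n, j))).
  rewrite ler_sum_nat// => j /andP[_ jk].
  rewrite expr1n mul1r -[leRHS]mulr_natl; apply: ler_wpM2l => //.
  exact: ler_wiXn2l.
have term0 j : 0 <= (1 ^+ (n - j) * x ^+ j) *+ 'C(n, j).
  by rewrite mulrn_wge0// mulr_ge0// exprn_ge0.
have [kn|nk] := leqP k n.
  by rewrite (big_cat_nat _ (n := k.+1) (p := n.+1))//= lerDl sumr_ge0.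
rewrite (big_cat_nat _ (n := n.+1) (p := k.+1))//=; last by rewrite ltnS ltnW.
rewrite [X in _ + X]big_nat_cond [X in _ + X]big1 ?addr0// => j /andP[/andP[nj _] _].
by rewrite bin_small.
Qed.

Lemma card_small_sets (n k : nat) :
  #|[set B : {set 'I_n} | #|B| <= k]%N| = (\sum_(j < k.+1) 'C(n, j))%N.
Proof.
under eq_bigr => j _.
  rewrite -[X in 'C(X, _)](card_ord n) -card_draws -sum1_card.
  under eq_bigl do rewrite inE.
  over.
rewrite -sum1_card; under eq_bigl do rewrite inE.
rewrite (partition_big (fun B : {set 'I_n} => inord #|B| : 'I_k.+1) xpredT)//=.
apply: eq_bigr => j _; apply: eq_bigl => B.
apply/andP/eqP => [[Bk /eqP <-]|->]; first by rewrite inordK.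
by rewrite inord_val -ltnS.
Qed.

(** A labeling with few errors is a sign pattern together with the set of
    positions where it is flipped. *)
Lemma card_hamming_nbhd_le (n k : nat) (S : {set n.-tuple bool}) :
  (#|[set y : n.-tuple bool | [exists s in S,
       #|[set i | tnth y i != tnth s i]| <= k]]| <=
   #|S| * \sum_(j < k.+1) 'C(n, j))%N.
Proof.
rewrite -card_small_sets -cardsX.
set f := fun p : n.-tuple bool * {set 'I_n} =>
  [tuple tnth p.1 i (+) (i \in p.2) | i < n].
apply: leq_trans (leq_imset_card f _); apply: subset_leq_card.
apply/fintype.subsetP => y; rewrite inE => /exists_inP[s sS ysk].
apply/imsetP; exists (s, [set i | tnth y i != tnth s i]); first by rewrite !inE sS.
apply: eq_from_tnth => i; rewrite tnth_mktuple inE.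
by case: (tnth y i) (tnth s i) => -[].
Qed.

(** * Domination of labeled samples by samples of points *)

Section label_domination.
Context {dX : measure_display} {X : measurableType dX} {R : realType}.
Local Open Scope classical_set_scope.

Definition attach {n} (x : n.-tuple X) (y : n.-tuple bool) : n.-tuple (X * bool) :=
  [tuple (tnth x i, tnth y i) | i < n].

Lemma measurable_attach n (y : n.-tuple bool) :
  measurable_fun [set: n.-tuple X] (attach ^~ y).
Proof.
apply/measurable_fun_tnthP => i.
rewrite (_ : _ \o _ = fun x : n.-tuple X => (tnth x i, tnth y i)); last first.
  by apply/funext => x /=; rewrite tnth_mktuple.
by apply: measurable_fun_pair => //; exact: measurable_tnth.
Qed.

Lemma big_tuple_boolS n (F : n.+1.-tuple bool -> \bar R) :
  (\sum_y F y = \sum_(y : n.-tuple bool) F [tuple of true :: y] +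
                \sum_(y : n.-tuple bool) F [tuple of false :: y])%E.
Proof.
rewrite (reindex (fun p : bool * n.-tuple bool => [tuple of p.1 :: p.2])) /=.
  rewrite -(pair_bigA _ (fun b (y : n.-tuple bool) => F [tuple of b :: y])) /=.
  by rewrite big_bool.
exists (fun t => (thead t, [tuple of behead t])) => [[b y] _|t _] /=.
  by congr (_, _); apply: val_inj.
by rewrite -tuple_eta.
Qed.

Definition with_label (b : bool) (x : X) : X * bool := (x, b).

Lemma measurable_with_label b : measurable_fun [set: X] (with_label b).
Proof. exact: pair2_measurable. Qed.

HB.instance Definition _ b :=
  isMeasurableFun.Build _ _ _ _ (with_label b) (measurable_with_label b).

Variables (P : probability (X * bool)%type R) (N : probability X R).
Hypothesis PN : forall A, measurable A ->
  (P A <= N [set x | A (x, true)] + N [set x | A (x, false)])%E.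

Let integral_le (f : X * bool -> \bar R) :
  measurable_fun [set: X * bool] f -> (forall z, 0 <= f z)%E ->
  (\int[P]_z f z <= \int[N]_x f (x, true) + \int[N]_x f (x, false))%E.
Proof.
move=> mf f0.
pose Q := measure_add (distribution N (with_label true))
                      (distribution N (with_label false)).
apply: (@le_trans _ _ (\int[Q]_z f z)%E).
  apply: ge0_le_measure_integral => // A mA.
  by rewrite /= /msum !big_ord_recl big_ord0 adde0; exact: PN.
by rewrite ge0_integral_measure_add// !ge0_integral_distribution.
Qed.

(** Conditionally on the points every labeling has probability at most 1, so the
    law of the sample is dominated by the sum over all labelings of the law of
    the points.  This replaces densities and conditional laws altogether. *)
Lemma iid_law_le_sum_attach n (E : set (n.-tuple (X * bool))) : measurable E ->
  (iid_law P n E <=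
   \sum_(y : n.-tuple bool) iid_law N n [set x | E (attach x y)])%E.
Proof.
elim: n E => [|n IH] E mE.
  rewrite (bigD1 [tuple]) //= big1 ?adde0; last first.
    by move=> y /eqP[]; rewrite (tuple0 y).
  rewrite !diracE /= (_ : ([tuple] \in E) =
    ([tuple] \in [set x | E (attach x [tuple])]))//.
  by apply/idP/idP; rewrite !inE /= (tuple0 (attach _ _)).
pose E' := @tcons _ (X * bool)%type n @^-1` E.
have mE' : measurable E'.
  by rewrite -[E']setTI; exact: measurable_tcons.
pose H (y : n.-tuple bool) :=
  [set z : (X * bool) * n.-tuple X | E' (z.1, attach z.2 y)].
have mH y : measurable (H y).
  have mk : measurable_fun setT
      (fun z : (X * bool) * n.-tuple X => (z.1, attach z.2 y)).
    apply: measurable_fun_pair; first exact: measurable_fst.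
    exact: (measurableT_comp (measurable_attach _ y) measurable_snd).
  by rewrite -[H y]setTI; exact: mk.
rewrite /= /distribution /pushforward /= -/E' /product_measure1.
apply: (@le_trans _ _ (\int[P]_z (\sum_(y : n.-tuple bool)
    iid_law N n (xsection (H y) z)))%E).
  apply: ge0_le_integral => //.
  - exact: measurable_fun_xsection.
  - by apply: emeasurable_sum => y; exact: measurable_fun_xsection.
  - move=> z _ /=; apply: le_trans (IH _ (measurable_xsection _ mE')) _.
    apply: lee_sum => y _; rewrite le_eqVlt; apply/orP; left; apply/eqP.
    by congr (iid_law N n _); apply/seteqP; split => x /=;
      rewrite /xsection /= !inE.
rewrite ge0_integral_sum//; last by move=> y; exact: measurable_fun_xsection.
rewrite big_tuple_boolS -big_split /=; apply: lee_sum => y _.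
apply: le_trans (integral_le _ _ _) _ => //; first exact: measurable_fun_xsection.
rewrite le_eqVlt; apply/orP; left; apply/eqP.
have attachS b (x : X) (t : n.-tuple X) :
    attach (tcons (x, t)) [tuple of b :: y] = tcons ((x, b), attach t y).
  apply: eq_from_tnth => i; rewrite tnth_mktuple /tcons.
  by case: (unliftP ord0 i) => [j ->|->]; rewrite ?tnthS ?tnth_mktuple ?tnth0.
rewrite /= /distribution /pushforward /product_measure1.
by congr (_ + _)%E; apply: eq_integral => x _; congr (iid_law N n _);
  apply/seteqP; split => t /=; rewrite /xsection /= !inE /H /E' /= attachS.
Qed.

End label_domination.

(** Summing the domination over the family of laws turns the sum of the
    probabilities of the events into the integral of a cardinal. *)
Lemma sum_iid_law_le (dX : measure_display) (X : measurableType dX)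
    (R : realType) (I : finType) (P : I -> probability (X * bool)%type R)
    (N : probability X R) (n : nat)
    (E : I -> set (n.-tuple (X * bool))) (M : nat) :
  (forall i A, measurable A ->
    (P i A <= N [set x | A (x, true)]%classic +
              N [set x | A (x, false)]%classic)%E) ->
  (forall i, measurable (E i)) ->
  (forall x : n.-tuple X,
    #|[set p : I * n.-tuple bool | `[< E p.1 (attach x p.2) >]]| <= M)%N ->
  (\sum_i iid_law (P i) n (E i) <= M%:R%:E)%E.
Proof.
move=> PN mE cardE.
pose F (p : I * n.-tuple bool) : set (n.-tuple X) :=
  [set x | E p.1 (attach x p.2)]%classic.
have mF p : measurable (F p).
  rewrite -[F p]setTI.
  exact: (measurable_attach _ p.2 measurableT _ (mE p.1)).
apply: (@le_trans _ _ (\sum_p iid_law N n (F p))%E).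
  rewrite -(pair_bigA _ (fun i y => iid_law N n (F (i, y)))) /=.
  apply: lee_sum => i _; apply: iid_law_le_sum_attach => //; exact: PN.
under eq_bigr => p _ do rewrite -[F p]setIT -integral_indic//.
rewrite -ge0_integral_sum//; last first.
  by move=> p; apply/measurable_EFinP; exact: measurable_indic.
apply: (@le_trans _ _ (\int[iid_law N n]_x (cst M%:R%:E x))%E); last first.
  rewrite integral_cst//= -[leRHS]mule1; apply: lee_wpmul2l => //.
  by rewrite -(probability_setT (iid_law N n)).
apply: ge0_le_integral => //.
- by move=> x _; exact: sume_ge0.
- apply: emeasurable_sum => p; apply/measurable_EFinP; exact: measurable_indic.
move=> x _; rewrite sumEFin lee_fin.
apply: le_trans (_ : #|[set p : I * n.-tuple bool |
  `[< E p.1 (attach x p.2) >]]|%:R <= _); last by rewrite ler_nat.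
rewrite -sum1_card natr_sum [leRHS]big_mkcond /=; apply: ler_sum => p _.
rewrite indicE inE; case: asboolP => Ep; first by rewrite mem_set.
by rewrite memNset.
Qed.

Lemma logistic_lawE (R : realType) (d : nat) (beta : \bar R)
    (theta : d.-tuple R) (A : set (d.-tuple R * bool)) :
  let p x := response_prob beta (dotp x theta) in
  logistic_law beta theta A =
  (\int[std_normal d]_x (p x * \1_[set x | A (x, true)]%classic x +
                          (1 - p x) * \1_[set x | A (x, false)]%classic x)%:E)%E.
Proof.
move=> p; apply: eq_integral => x _.
rewrite /label_law /= bernoulli_probE ?response_prob01// !diracE !indicE.
rewrite -!EFinM -EFinD.
have secE b : (b \in xsection A x) = (x \in [set x | A (x, b)]%classic).
  by apply/idP/idP; rewrite /xsection !inE /= !inE.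
by rewrite !secE.
Qed.

Lemma logistic_law_le_labels (R : realType) (d : nat) (beta : \bar R)
    (theta : d.-tuple R) (A : set (d.-tuple R * bool)) : measurable A ->
  (logistic_law beta theta A <=
   std_normal d [set x | A (x, true)]%classic +
   std_normal d [set x | A (x, false)]%classic)%E.
Proof.
move=> mA.
have mAb b : measurable [set x | A (x, b)]%classic.
  by rewrite -[X in measurable X]setTI; exact: measurable_with_label.
have mind b : measurable_fun setT (\1_[set x | A (x, b)]%classic : _ -> R).
  exact: measurable_indic.
rewrite logistic_lawE; pose p x := response_prob beta (dotp x theta).
have mp : measurable_fun [set: d.-tuple R]%classic p.
  exact: (measurableT_comp (measurable_response_prob beta)
                           (measurable_dotp theta)).
have p01 x : 0 <= p x <= 1 by exact: response_prob01.
apply: (@le_trans _ _ (\int[std_normal d]_x (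
   (\1_[set x | A (x, true)]%classic x)%:E +
   (\1_[set x | A (x, false)]%classic x)%:E))%E).
  apply: ge0_le_integral => //.
  - move=> x _; have /andP[? ?] := p01 x.
    by rewrite lee_fin addr_ge0// mulr_ge0// subr_ge0.
  - apply/measurable_EFinP; apply: measurable_funD; apply: measurable_funM => //.
    exact: measurable_funB.
  - by apply: emeasurable_funD; apply/measurable_EFinP.
  move=> x _; have /andP[? ?] := p01 x; rewrite -EFinD lee_fin.
  by apply: lerD; rewrite ler_piMl// gerBl.
rewrite ge0_integralD//; [|by apply/measurable_EFinP..].
by rewrite !integral_indic// !setIT.
Qed.

(** * Laplace transforms and small balls *)

(** The left-hand side is the integral over s >= 0 of b * exp (- b * s) times the
    probability that g <= s, hence at most the integral of b * exp (- b * s) * K * s,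
    which is [K / b].  The proof replaces the integral over [s] by a finite sum,
    with a staircase majorant of the exponential whose step is sent to 0. *)
Lemma laplace_le_of_small_ball (dT : measure_display) (T : measurableType dT)
    (R : realType) (P : probability T R) (g : T -> R) (K b : R) :
  measurable_fun setT g -> (forall x, 0 <= g x) -> 0 <= K -> 0 < b ->
  (forall s, 0 <= s -> (P [set x | (g x <= s)%R]%classic <= (K * s)%:E)%E) ->
  (\int[P]_x (expR (- (b * g x)))%:E <= (K / b)%:E)%E.
Proof.
move=> mg g0 K0 b0 Pg; apply/lee_addgt0Pr => e e0.
pose h := e / (2 * (K + 1)).
have h0 : 0 < h by rewrite divr_gt0// mulr_gt0// ltr_wpDl.
have bh0 : 0 < b * h by exact: mulr_gt0.
have bh1 : 0 < 1 + b * h by exact: addr_gt0.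
pose q := expR (- (b * h)).
have q0 : 0 < q := expR_gt0 _.
have q1 : q < 1 by rewrite expR_lt1 oppr_lt0.
have qX j : q ^+ j = expR (- (b * (h * j%:R))).
  by rewrite /q -expRM_natr; congr expR; ring.
pose J := (Num.truncn (2 / (e * b * h))).+1.
have qJ : q ^+ J <= e / 2.
  have eJ : 2 / e <= expR (b * (h * J%:R)).
    apply: le_trans (expR_ge1Dx _); apply: ler_wpDl => //.
    have -> : 2 / e = b * (h * (2 / (e * b * h))).
      by field; rewrite !gt_eqF.
    by rewrite !ler_pM2l// ltW// truncnS_gt.
  rewrite qX expRN -[e / 2]invrK lef_pV2 ?posrE ?expR_gt0 ?invr_gt0 ?divr_gt0//.
  by rewrite invf_div.
have w0 j : 0 <= q ^+ j - q ^+ j.+1.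
  by rewrite subr_ge0 exprS ler_piMl ?exprn_ge0// ltW.
pose A j := [set x | g x <= h * j.+1%:R]%classic.
have mA j : measurable (A j).
  by rewrite -[A j]setTI; exact: measurable_fun_le.
have mI j : measurable_fun setT (fun x => (\1_(A j) x)%:E : \bar R).
  by apply/measurable_EFinP; exact: measurable_indic.
(* The decreasing function exp (- b t) lies below its staircase majorant with
   steps of width h, cut off after J steps. *)
have stair x n : expR (- (b * g x)) <=
    \sum_(j < n) (q ^+ j - q ^+ j.+1) * \1_(A j) x + q ^+ n.
  elim: n => [|n IHn].
    by rewrite big_ord0 add0r expr0 expR_le1 oppr_le0 mulr_ge0// ltW.
  rewrite big_ord_recr /= indicE; have [gx|gx] := lerP (g x) (h * n.+1%:R).
    by rewrite mem_set// mulr1 -addrA subrK.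
  rewrite memNset /=; last by rewrite /A /= leNgt gx.
  rewrite mulr0 addr0 big1; last first.
    move=> j _; rewrite indicE memNset ?mulr0// /A /=; apply/negP.
    rewrite -ltNge; apply: le_lt_trans gx.
    by rewrite ler_pM2l// ler_nat ltnS ltnW.
  rewrite add0r qX ler_expR lerN2 ler_pM2l//; exact: ltW.
have sum_w n : \sum_(j < n) (q ^+ j - q ^+ j.+1) * j.+1%:R * (1 - q) <= 1.
  suff -> : \sum_(j < n) (q ^+ j - q ^+ j.+1) * j.+1%:R * (1 - q) =
      1 - q ^+ n - n%:R * q ^+ n * (1 - q).
    rewrite -addrA -opprD gerBl addr_ge0 ?exprn_ge0 ?mulr_ge0 ?exprn_ge0//.
    by rewrite ltW.
    by rewrite ltW.
    by rewrite subr_ge0 ltW.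
  elim: n => [|n IHn]; first by rewrite big_ord0 expr0; ring.
  by rewrite big_ord_recr /= IHn -natr1 exprS; ring.
have hq : h / (1 - q) <= b^-1 + h.
  rewrite ler_pdivrMr ?subr_gt0//.
  have qle : q <= (1 + b * h)^-1.
    by rewrite /q expRN lef_pV2 ?posrE ?expR_gt0// expR_ge1Dx.
  have hE : h = (b^-1 + h) * (1 - (1 + b * h)^-1).
    by field; rewrite !gt_eqF.
  rewrite [leLHS]hE.
  by rewrite ler_pM2l ?addr_gt0 ?invr_gt0// lerB.
pose S x : \bar R :=
  (\sum_(j < J) ((q ^+ j - q ^+ j.+1) * \1_(A j) x)%:E)%E.
apply: (@le_trans _ _ (\int[P]_x (S x + (q ^+ J)%:E))%E).
  apply: ge0_le_integral => //.
  - apply/measurable_EFinP; apply: measurableT_comp => //.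
    by apply: measurable_funN; exact: measurable_funM.
  - apply: emeasurable_funD => //; apply: emeasurable_sum => j.
    by apply/measurable_EFinP; apply: measurable_funM.
  - by move=> x _; rewrite /S sumEFin -EFinD lee_fin stair.
rewrite /S ge0_integralD//; last 3 first.
- by move=> x _; apply: sume_ge0 => j _; rewrite lee_fin mulr_ge0.
- apply: emeasurable_sum => j; apply/measurable_EFinP; exact: measurable_funM.
- by move=> x _; rewrite lee_fin exprn_ge0// ltW.
rewrite integral_cst// [X in (_ * X)%E]probability_setT mule1.
rewrite ge0_integral_sum//; last 2 first.
- by move=> j; apply/measurable_EFinP; exact: measurable_funM.
- by move=> j x _; rewrite lee_fin mulr_ge0.
apply: (@le_trans _ _ (\sum_(j < J)
    ((q ^+ j - q ^+ j.+1) * (K * (h * j.+1%:R)))%:E + (q ^+ J)%:E)%E).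
  apply: leeD => //; apply: lee_sum => j _.
  under eq_integral do rewrite EFinM.
  rewrite ge0_integralZl//; last by rewrite lee_fin.
  rewrite integral_indic// setIT EFinM; apply: lee_wpmul2l.
    by rewrite lee_fin.
  by apply: Pg; rewrite mulr_ge0// ltW.
rewrite sumEFin -!EFinD lee_fin.
have -> : \sum_(j < J) (q ^+ j - q ^+ j.+1) * (K * (h * j.+1%:R)) =
    K * (h / (1 - q)) * \sum_(j < J) (q ^+ j - q ^+ j.+1) * j.+1%:R * (1 - q).
  rewrite mulr_sumr; apply: eq_bigr => j _.
  by field; rewrite subr_eq0 gt_eqF.
apply: (@le_trans _ _ (K * (b^-1 + h) + e / 2)).
  apply: lerD => //; rewrite -[leRHS]mulr1; apply: ler_pM => //.
  - by apply: mulr_ge0 => //; apply: divr_ge0; rewrite ?subr_ge0 ltW.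
  - by apply: sumr_ge0 => j _; rewrite mulr_ge0 ?mulr_ge0// subr_ge0 ltW.
  - exact: ler_wpM2l.
have Kh : K * h <= e / 2.
  have -> : e / 2 = (K + 1) * h.
    by rewrite /h; field; rewrite gt_eqF// ltr_wpDl.
  by rewrite ler_pM2r// lerDl.
by rewrite mulrDr -addrA lerD2l [leRHS](splitr e) lerD2r.
Qed.

(** * Probability of a label on the wrong side *)

Lemma std_normal1_affine_small_ball (R : realType) (a c s : R) :
  0 < a -> 0 <= s ->
  (std_normal1 [set t : R | (`|t * a + c| <= s)%R]%classic <=
   (Num.sqrt (2 / pi) / a * s)%:E)%E.
Proof.
move=> a0 s0.
have -> : [set t : R | (`|t * a + c| <= s)%R]%classic =
    `[(- s - c) / a, (s - c) / a]%classic.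
  apply/seteqP; split => t /=; rewrite in_itv /= ler_norml.
    by rewrite ler_pdivrMr// ler_pdivlMr// lerBlDr lerBrDr.
  by rewrite ler_pdivrMr// ler_pdivlMr// lerBlDr lerBrDr.
set I := (X in std_normal1 X).
have mI : measurable I by exact: measurable_itv.
rewrite /std_normal1 /= /distribution /pushforward /normal_prob.
apply: (@le_trans _ _ (\int[lebesgue_measure]_(x in I) (normal_peak 1)%:E)%E).
  apply: ge0_le_integral => //.
  - by move=> x _; rewrite lee_fin normal_pdf_ge0.
  - apply/measurable_EFinP; apply: measurable_funTS; exact: measurable_normal_pdf.
  - by move=> x _; rewrite lee_fin normal_pdf_ub.
rewrite integral_cst//= lebesgue_measure_itv /= lte_fin.
have peakE : normal_peak 1 * 2 = Num.sqrt (2 / pi) :> R.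
  rewrite /normal_peak expr1n mul1r -[2 in LHS]sqr_sqrtr//.
  rewrite -[pi *+ 2]mulr_natl sqrtrM// sqrtrM// sqrtrV ?pi_ge0//.
  by field; rewrite !gt_eqF ?sqrtr_gt0// pi_gt0.
case: ifPn => _.
  rewrite -EFinB -EFinM lee_fin -peakE le_eqVlt; apply/orP; left; apply/eqP.
  by field; rewrite gt_eqF.
by rewrite mule0 lee_fin !mulr_ge0// ?invr_ge0 ltW.
Qed.

Lemma dotpS (R : realType) (m : nat) (x : R) (t : m.-tuple R)
    (theta : m.+1.-tuple R) :
  dotp (tcons (x, t)) theta =
  x * tnth theta ord0 + dotp t [tuple of behead theta].
Proof.
rewrite /dotp big_ord_recl /tcons tnth0; congr (_ + _).
apply: eq_bigr => i _; rewrite tnthS tnth_behead; congr (_ * tnth _ _).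
by apply: val_inj => /=; rewrite inordK // ltnS.
Qed.

(** Given the other coordinates of the point, the first one is a standard normal
    variable whose density is at most 1 / sqrt (2 pi).  This gives away a factor
    [tnth theta ord0] with respect to the rotation invariance of the normal law,
    which is harmless for parameters close to the first basis vector. *)
Lemma std_normal_small_ball (R : realType) (m : nat) (theta : m.+1.-tuple R)
    (s : R) : 0 < tnth theta ord0 -> 0 <= s ->
  (std_normal m.+1 [set x | (`|dotp x theta| <= s)%R]%classic <=
   (Num.sqrt (2 / pi) / tnth theta ord0 * s)%:E)%E.
Proof.
move=> a0 s0; set A := (X in std_normal _ X).
have mA : measurable A.
  rewrite -[A]setTI; apply: measurable_fun_le => //.
  by apply: measurableT_comp => //; exact: measurable_dotp.
rewrite /std_normal /= /distribution /pushforward /=.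
set B := (_ @^-1` A)%classic.
have mB : measurable B by rewrite -[B]setTI; exact: measurable_tcons.
rewrite /product_measure1.
have := indic_fubini_tonelli std_normal1 (iid_law std_normal1 m) mB.
rewrite indic_fubini_tonelli_FE// indic_fubini_tonelli_GE// => ->.
apply: (@le_trans _ _ (\int[iid_law std_normal1 m]_x
   (cst (Num.sqrt (2 / pi) / tnth theta ord0 * s)%:E x))%E).
  apply: ge0_le_integral => //.
  - exact: measurable_fun_ysection.
  move=> t _ /=; rewrite (_ : ysection B t =
    [set x : R | (`|x * tnth theta ord0 +
                    dotp t [tuple of behead theta]| <= s)%R]%classic).
    exact: std_normal1_affine_small_ball.
  by apply/seteqP; split => x; rewrite /ysection /= inE /B /A /= dotpS.
by rewrite integral_cst// [X in (_ * X)%E]probability_setT mule1.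
Qed.

Definition mislabeled {R : realType} {d : nat} (theta : d.-tuple R) :
    set (d.-tuple R * bool) :=
  [set z | z.2 != (0 < dotp z.1 theta)]%classic.

Lemma measurable_mislabeled (R : realType) (d : nat) (theta : d.-tuple R) :
  measurable (mislabeled theta).
Proof.
pose H := [set x : d.-tuple R | (0 < dotp x theta)%R]%classic.
have mH : measurable H.
  rewrite -[H]setTI.
  apply: (_ : measurable_fun _ _) measurableT [set true]%classic _ => //.
  by apply: measurable_fun_ltr => //; exact: measurable_dotp.
rewrite (_ : mislabeled theta =
  (~` H `*` [set true] `|` H `*` [set false])%classic).
  by apply: measurableU; apply: measurableX => //; exact: measurableC.
apply/seteqP; split => -[x b]; rewrite /mislabeled /H /=.
  by case: b (0 < dotp x theta) => -[]// _; [left|right].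
by case=> -[h ->]; rewrite ?h//; move/negP: h => /negbTE ->.
Qed.

Lemma logistic_mislabeled_oo (R : realType) (d : nat) (theta : d.-tuple R) :
  logistic_law +oo%E theta (mislabeled theta) = 0%E.
Proof.
rewrite logistic_lawE integral0_eq// => x _ /=; congr _%:E.
rewrite !indicE /mislabeled /=.
case: ifPn => xt; rewrite ?subrr ?mul0r ?add0r ?mul1r ?addr0.
  by rewrite memNset//= xt.
by rewrite memNset ?mulr0//= (negbTE xt).
Qed.

(** Given the point, the label disagrees with the sign of t = dotp x theta with
    probability 1 / (1 + exp (b |t|)) <= exp (- b |t|). *)
Lemma logistic_mislabeled_le (R : realType) (m : nat) (theta : m.+1.-tuple R)
    (b : R) : 0 < b -> 0 < tnth theta ord0 ->
  (logistic_law b%:E theta (mislabeled theta) <=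
   (Num.sqrt (2 / pi) / (tnth theta ord0 * b))%:E)%E.
Proof.
move=> b0 a0; rewrite logistic_lawE.
have mabs : measurable_fun setT (fun x : m.+1.-tuple R => `|dotp x theta|).
  by apply: measurableT_comp => //; exact: measurable_dotp.
apply: (@le_trans _ _
    (\int[std_normal m.+1]_x (expR (- (b * `|dotp x theta|)))%:E)%E).
  apply: ge0_le_integral => //.
  - move=> x _; have /andP[p0 p1] := response_prob01 b%:E (dotp x theta).
    by rewrite lee_fin addr_ge0// mulr_ge0// subr_ge0.
  - have mp : measurable_fun [set: m.+1.-tuple R]%classic
        (fun x => response_prob b%:E (dotp x theta)).
      exact: (measurableT_comp (measurable_response_prob b%:E)
                               (measurable_dotp theta)).
    have mi c : measurable_fun [set: m.+1.-tuple R]%classic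
        (\1_[set x | mislabeled theta (x, c)]%classic : _ -> R).
      apply: measurable_indic; rewrite -[X in measurable X]setTI.
      apply: measurable_with_label => //; exact: measurable_mislabeled.
    apply/measurable_EFinP; apply: measurable_funD; apply: measurable_funM => //.
    exact: measurable_funB.
  - apply/measurable_EFinP; apply: measurableT_comp => //.
    by apply: measurable_funN; exact: measurable_funM.
  move=> x _; rewrite lee_fin !indicE /mislabeled /=.
  have [xt|xt] := ltP 0 (dotp x theta).
    rewrite memNset; last by rewrite /= xt.
    rewrite mem_set; last by rewrite /= xt.
    rewrite mulr0 add0r mulr1 ger0_norm ?(ltW xt)//.
    set u := b * _; have e0 := expR_gt0 (- u).
    rewrite [leLHS](_ : _ = expR (- u) / (1 + expR (- u))).
      by rewrite ler_pdivrMr ?addr_gt0// ler_pMr// lerDl ltW.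
    by field; rewrite gt_eqF// addr_gt0.
  have xtF : (0 < dotp x theta) = false by rewrite ltNge xt.
  rewrite mem_set; last by rewrite /= xtF.
  rewrite memNset; last by rewrite /= xtF.
  rewrite mulr0 addr0 mulr1 ler0_norm// mulrN [leRHS]expRN.
  rewrite lef_pV2 ?posrE ?addr_gt0 ?expR_gt0// lerDr //.
rewrite invfM mulrA; apply: laplace_le_of_small_ball => //.
  by rewrite divr_ge0 ?sqrtr_ge0// ltW.
by move=> s s0; exact: std_normal_small_ball.
Qed.

(** * Packing Euclidean balls *)

Lemma exists_exprn_gt (R : realType) (x C : R) : 1 < x ->
  exists j : nat, C < x ^+ j.
Proof.
move=> x1; have lx : 0 < ln x by exact: ln_gt0.
pose j := (Num.truncn (C / ln x)).+1; exists j.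
have -> : x ^+ j = expR (ln x * j%:R).
  by rewrite expRM_natr lnK// posrE (lt_trans _ x1).
apply: lt_le_trans (expR_ge1Dx _); apply: ltr_wpDl => //.
by rewrite mulrC -ltr_pdivrMr// truncnS_gt.
Qed.

Section euclidean_rows.
Context {R : realType} {m : nat}.
Implicit Types u v : 'rV[R]_m.

Definition l2 u : R := Num.sqrt (\sum_i u 0 i ^+ 2).

Lemma sqr_l2 u : l2 u ^+ 2 = \sum_i u 0 i ^+ 2.
Proof. by rewrite sqr_sqrtr// sumr_ge0// => i _; exact: sqr_ge0. Qed.

Lemma l2_ge0 u : 0 <= l2 u. Proof. exact: sqrtr_ge0. Qed.

Lemma cauchy_schwarz u v : \sum_i u 0 i * v 0 i <= l2 u * l2 v.
Proof.
set S := \sum_i _.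
have [v0|v0] := eqVneq (l2 v) 0.
  rewrite v0 mulr0 /S big1// => i _.
  have /eqP := sqr_l2 v; rewrite v0 expr0n /= eq_sym psumr_eq0; last first.
    by move=> k _; exact: sqr_ge0.
  move/allP/(_ i (mem_index_enum i)); rewrite sqrf_eq0 => /eqP ->.
  by rewrite mulr0.
have vp : 0 < l2 v by rewrite lt_def v0 l2_ge0.
have : 0 <= \sum_i (u 0 i * l2 v ^+ 2 - v 0 i * S) ^+ 2.
  by apply: sumr_ge0 => i _; exact: sqr_ge0.
have -> : \sum_i (u 0 i * l2 v ^+ 2 - v 0 i * S) ^+ 2 =
    l2 v ^+ 2 * ((l2 u * l2 v) ^+ 2 - S ^+ 2).
  have expand (a b : R) : \sum_i (u 0 i * a - v 0 i * b) ^+ 2 =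
      a ^+ 2 * (\sum_i u 0 i ^+ 2) - 2 * a * b * (\sum_i u 0 i * v 0 i) +
      b ^+ 2 * (\sum_i v 0 i ^+ 2).
    rewrite !mulr_sumr -sumrB -big_split /=.
    by apply: eq_bigr => i _; ring.
  by rewrite expand -!sqr_l2 -/S; ring.
rewrite pmulr_rge0 ?exprn_gt0// subr_ge0 => SS.
apply: le_trans (ler_norm S) _.
by rewrite -ler_sqr ?nnegrE ?mulr_ge0 ?l2_ge0// real_normK ?num_real.
Qed.

Lemma l2_triangle u v : l2 (u + v) <= l2 u + l2 v.
Proof.
rewrite -ler_sqr ?nnegrE ?addr_ge0 ?l2_ge0// sqrrD !sqr_l2.
rewrite -(mulr_natl (_ * _)).
have -> : \sum_i (u + v) 0 i ^+ 2 = \sum_i u 0 i ^+ 2 +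
    2 * (\sum_i u 0 i * v 0 i) + \sum_i v 0 i ^+ 2.
  rewrite mulr_sumr -!big_split /=; apply: eq_bigr => i _.
  by rewrite mxE; ring.
by rewrite lerD2r lerD2l ler_pM2l// cauchy_schwarz.
Qed.

Lemma l2Z (a : R) u : l2 (a *: u) = `|a| * l2 u.
Proof.
rewrite /l2 -sqrtr_sqr -sqrtrM ?sqr_ge0// mulr_sumr.
by congr Num.sqrt; apply: eq_bigr => i _; rewrite mxE exprMn.
Qed.

Lemma l2N u : l2 (- u) = l2 u.
Proof. by rewrite -scaleN1r l2Z normrN1 mul1r. Qed.

Lemma ler_norm_l2 u i : `|u 0 i| <= l2 u.
Proof.
rewrite -sqrtr_sqr; apply: ler_wsqrtr; rewrite (bigD1 i)//= lerDl.
by apply: sumr_ge0 => j _; exact: sqr_ge0.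
Qed.

Lemma l2_le_max u (a : R) : (forall i, `|u 0 i| <= a) -> l2 u <= m%:R * a.
Proof.
move=> ua; case: (posnP m) => [m0|m0].
  rewrite /l2 big1 ?sqrtr0 ?m0 ?mul0r// => i.
  by have := ltn_ord i; rewrite {2}m0.
have a0 : 0 <= a by apply: le_trans (ua (Ordinal m0)).
rewrite -ler_sqr ?nnegrE ?mulr_ge0 ?l2_ge0// sqr_l2 exprMn.
apply: (@le_trans _ _ (\sum_(i < m) a ^+ 2)).
  apply: ler_sum => i _; rewrite -ler_sqrt ?sqr_ge0// !sqrtr_sqr.
  by rewrite (ger0_norm a0).
rewrite sumr_const card_ord -[leLHS]mulr_natl ler_wpM2r ?sqr_ge0//.
by rewrite -natrX ler_nat expnS expn1 leq_pmulr.
Qed.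

End euclidean_rows.

Section packing.
Context {R : realType} (m : nat) (rho eta : R).
Hypotheses (rho0 : 0 < rho) (eta0 : 0 < eta).
Let q := rho / eta.

Definition separated (s : seq 'rV[R]_m) :=
  all (fun u => l2 u <= rho) s && pairwise (fun u v => eta <= l2 (u - v)) s.

Let q0 : 0 < q. Proof. exact: divr_gt0. Qed.

(** A cover of the ball of radius [rho] by balls of radius [eta] can be rescaled
    to cover each of these smaller balls, and so on. *)
Lemma iterated_cover (s : seq 'rV[R]_m) :
  (forall u, l2 u <= rho -> exists2 c, c \in s & l2 (u - c) < eta) ->
  forall j, exists2 t : seq 'rV[R]_m, size t = (size s ^ j)%N &
    forall u, l2 u <= rho -> exists2 c, c \in t & l2 (u - c) <= rho / q ^+ j.
Proof.
move=> cov; elim=> [|j [t szt covt]].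
  by exists [:: 0] => // u ur; exists 0; rewrite ?mem_seq1// subr0 expr0 divr1.
have qj0 : 0 < q ^+ j by exact: exprn_gt0.
exists [seq c + q ^- j *: d | c <- t, d <- s].
  by rewrite size_allpairs szt expnSr.
move=> u ur; have [c ct uc] := covt u ur.
have [|d ds vd] := cov (q ^+ j *: (u - c)).
  by rewrite l2Z gtr0_norm// mulrC -ler_pdivlMr.
exists (c + q ^- j *: d); first exact: allpairs_f.
have -> : u - (c + q ^- j *: d) = q ^- j *: (q ^+ j *: (u - c) - d).
  by rewrite scalerBr scalerA mulVf ?gt_eqF// scale1r opprD addrA.
rewrite l2Z gtr0_norm ?invr_gt0//.
have -> : rho / q ^+ j.+1 = q ^- j * eta.
  by rewrite exprS /q; field; rewrite !gt_eqF// exprn_gt0// divr_gt0.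
by rewrite ler_pM2l ?invr_gt0// ltW.
Qed.

(** A cubic grid of step [delta] inside the ball has at most one point in each
    ball of radius less than [delta / 2]. *)
Lemma grid_le_cover (j K : nat) (t : seq 'rV[R]_m) : (0 < m)%N -> (0 < K)%N ->
  (forall u, l2 u <= rho -> exists2 c, c \in t & l2 (u - c) <= rho / q ^+ j) ->
  2 * m%:R * K%:R < q ^+ j -> (K ^ m <= size t)%N.
Proof.
move=> m0 K0 cov Kq.
pose delta : R := rho / (m%:R * K%:R).
have mK0 : 0 < m%:R * K%:R :> R by rewrite mulr_gt0// ltr0n.
have d0 : 0 < delta by exact: divr_gt0.
pose pt (g : {ffun 'I_m -> 'I_K}) : 'rV[R]_m := \row_i (delta * (g i)%:R).
have ptr g : l2 (pt g) <= rho.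
  apply: le_trans (_ : m%:R * (delta * K%:R) <= _); last first.
    rewrite le_eqVlt /delta; apply/orP; left; apply/eqP; field.
    by rewrite !gt_eqF// ltr0n.
  apply: l2_le_max => i; rewrite mxE normrM (gtr0_norm d0) ger0_norm//.
  by rewrite ler_pM2l// ler_nat ltnW.
have [c ct] : exists2 c : {ffun 'I_m -> 'I_K} -> 'rV[R]_m,
    (forall g, c g \in t) & (forall g, l2 (pt g - c g) <= rho / q ^+ j).
  have /choice[c cP] : forall g, exists c,
      c \in t /\ l2 (pt g - c) <= rho / q ^+ j.
    by move=> g; have [c ct gc] := cov _ (ptr g); exists c.
  by exists c => g; have [] := cP g.
move=> cd.
have cinj : injective c.
  move=> g h cgh; apply/ffunP => i; apply/eqP/negPn/negP => ghi.
  have : delta <= l2 (pt g - pt h).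
    apply: le_trans (ler_norm_l2 _ i); rewrite !mxE -mulrBr normrM.
    rewrite gtr0_norm// ler_pMr//.
    case: (ltngtP (g i) (h i)) => [gh|hg|/val_inj/eqP];
      last by rewrite (negbTE ghi).
      rewrite distrC ger0_norm ?subr_ge0 ?ler_nat 1?ltnW//.
      by rewrite lerBrDl natr1 ler_nat.
    rewrite ger0_norm ?subr_ge0 ?ler_nat 1?ltnW//.
    by rewrite lerBrDl natr1 ler_nat.
  apply/negP; rewrite -ltNge.
  have -> : pt g - pt h = (pt g - c g) - (pt h - c h).
    by rewrite cgh opprB addrA subrK.
  apply: le_lt_trans (l2_triangle _ _) _; rewrite l2N.
  apply: le_lt_trans (lerD (cd g) (cd h)) _.
  rewrite -mulr2n -[ltLHS]mulr_natl /delta mulrCA ltr_pM2l//.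
  rewrite ltr_pdivrMr ?exprn_gt0// mulrC ltr_pdivlMr//.
  by rewrite mulrA.
have := @uniq_leq_size _ [seq c g | g <- enum {ffun 'I_m -> 'I_K}] t.
rewrite map_inj_uniq// enum_uniq size_map -cardE card_ffun !card_ord; apply => //.
by move=> x /mapP[g _ ->].
Qed.

(** The volumetric packing bound, without volumes.  A maximal separated family
    of [M] points gives a cover by [M] balls, which iterated [j] times has M ^ j
    balls of radius rho / q ^ j.  As such a cover must have at least as many
    balls as a grid of that step has points, c * q ^ (m j) <= M ^ j for all [j],
    for a constant [c], and the constant disappears as [j] grows. *)
Lemma exists_separated :
  exists2 s : seq 'rV[R]_m, separated s & q ^+ m <= (size s)%:R.
Proof.
have sep0 : separated [:: 0].
  by rewrite /separated /= -(scale0r 0) l2Z normr0 mul0r ltW.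
have [m0|m0] := posnP m; first by exists [:: 0]; rewrite // {1}m0 expr0.
apply: contrapT => nosep.
have lt_sep s : separated s -> (size s)%:R < q ^+ m.
  by move=> ss; rewrite ltNge; apply/negP => qs; apply: nosep; exists s.
pose P k := `[< exists2 s, separated s & size s = k >].
have exP : exists k, P k by exists 1%N; apply/asboolP; exists [:: 0].
have ubP k : P k -> (k <= Num.truncn (q ^+ m))%N.
  case/asboolP => s /lt_sep/ltW + <-.
  by rewrite truncn_ge_nat// exprn_ge0// ltW.
case: (ex_maxnP exP ubP) => M /asboolP[s ss sM] maxM.
have M1 : (1 <= M)%N by apply: maxM; apply/asboolP; exists [:: 0].
have cov u : l2 u <= rho -> exists2 c, c \in s & l2 (u - c) < eta.
  move=> ur; apply: contrapT => nocov.
  have : P M.+1.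
    apply/asboolP; exists (u :: s); last by rewrite /= sM.
    case/andP: ss => bs ps; rewrite /separated /= ur bs ps /= andbT.
    apply/allP => c cs; rewrite leNgt; apply/negP => uc.
    by apply: nocov; exists c.
  by move/maxM; rewrite ltnn.
have Mq : M%:R < q ^+ m by rewrite -sM lt_sep.
have M0 : 0 < M%:R :> R by rewrite ltr0n.
have m4 : 0 < 4 * m%:R :> R by rewrite mulr_gt0// ltr0n.
have [j jP] : exists j, (4 * m%:R) ^+ m * M%:R ^+ j < (q ^+ m) ^+ j.
  have [|j jP] := @exists_exprn_gt _ (q ^+ m / M%:R) ((4 * m%:R) ^+ m).
    by rewrite ltr_pdivlMr// mul1r.
  by exists j; rewrite -ltr_pdivlMr ?exprn_gt0// -expr_div_n.
have qj4 : 4 * m%:R < q ^+ j.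
  rewrite -(ltr_pXn2r m0) ?nnegrE ?exprn_ge0 ?(ltW m4) ?(ltW q0)//.
  rewrite exprAC; apply: le_lt_trans jP.
  rewrite ler_peMr ?exprn_ge0 ?mulr_ge0// exprn_ege1//.
  by rewrite ler1n.
have [t szt covt] := iterated_cover _ cov j.
pose K := (Num.truncn (q ^+ j / (4 * m%:R))).+1.
have KM : (K ^ m <= M ^ j)%N.
  rewrite -sM -szt; apply: (@grid_le_cover j) => //.
  have : (Num.truncn (q ^+ j / (4 * m%:R)))%:R <= q ^+ j / (4 * m%:R).
    by rewrite truncn_le divr_ge0 ?exprn_ge0 ?(ltW m4) ?(ltW q0).
  rewrite ler_pdivlMr//.
  have aux (a Q T : R) : 4 * a < Q -> T * (4 * a) <= Q -> 2 * a * (T + 1) < Q.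
    by move=> aQ TQ; lra.
  by move/(aux _ _ _ qj4); rewrite natr1.
move: KM; apply/negP; rewrite -ltnNge -(ltr_nat R) !natrX.
have KG : q ^+ j / (4 * m%:R) < K%:R by exact: truncnS_gt.
apply: lt_le_trans (_ : (q ^+ j / (4 * m%:R)) ^+ m <= _); last first.
  have : 0 <= q ^+ j / (4 * m%:R).
    by rewrite divr_ge0 ?exprn_ge0 ?(ltW m4) ?(ltW q0).
  by move=> ?; apply: lerXn2r; rewrite ?nnegrE ?(ltW KG).
rewrite exprMn exprVn ltr_pdivlMr ?exprn_gt0 ?mulr_gt0 ?ltr0n//.
by rewrite -exprM mulnC exprM mulrC.
Qed.

End packing.

(** * Packing the sphere *)

Section sphere.
Context {R : realType}.

Definition rowt {d : nat} (x : d.-tuple R) : 'rV[R]_d := \row_i tnth x i.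

Lemma enormE (d : nat) (x : d.-tuple R) : enorm x = l2 (rowt x).
Proof.
rewrite /enorm /l2 /dotp; congr Num.sqrt.
by apply: eq_bigr => i _; rewrite mxE.
Qed.

Lemma rowt_tsub (d : nat) (x y : d.-tuple R) :
  rowt (tsub x y) = rowt x - rowt y.
Proof. by apply/rowP => i; rewrite !mxE tnth_mktuple. Qed.

Lemma enorm_tsub_le (d : nat) (x y z : d.-tuple R) :
  enorm (tsub x y) <= enorm (tsub z x) + enorm (tsub z y).
Proof.
rewrite !enormE !rowt_tsub -[X in _ <= X + _]l2N.
by apply: le_trans (l2_triangle _ _); rewrite opprB addrA subrK.
Qed.

Lemma dotp_sphere (d : nat) (x : d.-tuple R) : unit_sphere d x -> dotp x x = 1.
Proof.
rewrite /unit_sphere /enorm /= => x1.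
rewrite -[LHS]sqr_sqrtr ?x1 ?expr1n// sumr_ge0// => i _.
by rewrite -expr2 sqr_ge0.
Qed.

(** The chart of the upper hemisphere over the unit ball; it does not decrease
    distances, so it maps separated families to separated families. *)
Definition lift_sphere {m : nat} (u : 'rV[R]_m) : m.+1.-tuple R :=
  [tuple of Num.sqrt (1 - l2 u ^+ 2) :: [tuple u 0 i | i < m]].

Lemma tnth_lift_sphere (m : nat) (u : 'rV[R]_m) i :
  tnth (lift_sphere u) (lift ord0 i) = u 0 i.
Proof. by rewrite tnthS tnth_mktuple. Qed.

Lemma lift_sphere_unit (m : nat) (u : 'rV[R]_m) : l2 u <= 1 ->
  unit_sphere m.+1 (lift_sphere u).
Proof.
move=> u1; rewrite /unit_sphere /enorm /dotp /= big_ord_recl tnth0.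
under eq_bigr do rewrite tnth_lift_sphere -expr2.
rewrite -sqr_l2 -expr2 sqr_sqrtr ?subrK ?sqrtr1// subr_ge0.
by rewrite expr_le1// l2_ge0.
Qed.

Lemma l2_sub_le_lift (m : nat) (u v : 'rV[R]_m) :
  l2 (u - v) <= enorm (tsub (lift_sphere u) (lift_sphere v)).
Proof.
apply: ler_wsqrtr; rewrite /dotp big_ord_recl /=.
under [in leRHS]eq_bigr do
  rewrite tnth_mktuple !tnth_lift_sphere -expr2.
rewrite -expr2; under eq_bigr do rewrite !mxE.
by rewrite lerDr sqr_ge0.
Qed.

End sphere.

Lemma fact_double_ge (n : nat) : (2 ^ n * n`! <= n.*2`!)%N.
Proof.
elim: n => // n IHn; rewrite doubleS !factS expnS mulnACA mul2n doubleS.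
by rewrite leq_mul2l /= (leq_trans IHn)// leq_pmull.
Qed.

(** Termwise comparison of the two power series, by (2 n)! >= 2 ^ n n!. *)
Lemma cosh_le_gauss (R : realType) (x : R) :
  expR x + expR (- x) <= 2 * expR (x ^+ 2 / 2).
Proof.
pose S := fun y : R => series (exp_coeff y).
have S_cvg y : (S y n.*2 @[n --> \oo] --> expR y)%classic.
  apply: (@cvg_comp _ _ _ (fun n => n.*2) (S y) _ (\oo%classic)); last first.
    exact: is_cvg_series_exp_coeff.
  apply/cvgnyPge => A; near=> n.
  by rewrite -addnn (leq_trans _ (leq_addr _ _))//; near: n; exact: nbhs_infty_ge.
have S_le n : S (x ^+ 2 / 2) n <= expR (x ^+ 2 / 2).
  apply: nondecreasing_cvgn_le; last exact: is_cvg_series_exp_coeff.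
  apply: nondecreasing_series => k _ _.
  exact: exp_coeff_ge0 (divr_ge0 (sqr_ge0 _) _).
have coeffN k : exp_coeff (- x) k = (-1) ^+ k * exp_coeff x k.
  by rewrite /exp_coeff /= (exprNn x) mulrA.
have S_even n : S x n.*2 + S (- x) n.*2 <= 2 * S (x ^+ 2 / 2) n.
  rewrite /S /series /=; elim: n => [|n IHn].
    by rewrite !big_geq// addr0 mulr0.
  rewrite doubleS !big_nat_recr//= mulrDr.
  rewrite [leLHS](_ : _ = \sum_(0 <= i < n.*2) exp_coeff x i +
     \sum_(0 <= i < n.*2) exp_coeff (- x) i + 2 * exp_coeff x n.*2).
    apply: lerD => //; rewrite ler_pM2l// /exp_coeff /=.
    rewrite exprMn exprVn -exprM mul2n -mulrA -invfM ler_wpM2l//.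
      by rewrite -mul2n exprM exprn_ge0// sqr_ge0.
    rewrite lef_pV2 ?posrE ?mulr_gt0 ?exprn_gt0 ?ltr0n ?fact_gt0//.
    by rewrite -natrX -natrM ler_nat fact_double_ge.
  have -> : exp_coeff (- x) n.*2 = exp_coeff x n.*2.
    by rewrite coeffN -signr_odd odd_double expr0 mul1r.
  have -> : exp_coeff (- x) n.*2.+1 = - exp_coeff x n.*2.+1.
    by rewrite coeffN -signr_odd oddS odd_double expr1 mulN1r.
  by ring.
have lim : ((S x n.*2 + S (- x) n.*2) @[n --> \oo] --> expR x + expR (- x))%classic.
  by apply: cvgD; exact: S_cvg.
rewrite -(cvg_lim _ lim)//; apply: limr_le.
  by apply/cvg_ex; eexists; exact: lim.
by near=> n; apply: le_trans (S_even n) _; rewrite ler_pM2l.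
Unshelve. all: by end_near. Qed.

(** * Vertices of the cube near a point of the sphere *)

Definition cube_vertex (R : realType) (d : nat) (sigma : {ffun 'I_d -> bool}) :
    d.-tuple R :=
  [tuple (-1) ^+ sigma i / Num.sqrt d%:R | i < d].

Lemma cube_vertex_unit (R : realType) (d : nat) (sigma : {ffun 'I_d -> bool}) :
  (0 < d)%N -> unit_sphere d (cube_vertex R d sigma).
Proof.
move=> d0; rewrite /unit_sphere /enorm /dotp /=.
under eq_bigr do rewrite tnth_mktuple -expr2 expr_div_n sqr_sqrtr// sqrr_sign.
rewrite sumr_const card_ord -(mulr_natr (1 / d%:R)).
by rewrite divfK ?sqrtr1// pnatr_eq0 -lt0n.
Qed.

(** Chernoff's bound: a uniform vertex of the cube is a vector of independent
    signs, and to be at distance less than [eps < 1] from [x] its scalar product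
    with [x] must exceed 1 - eps ^ 2 / 2 > 1 / 2, a large deviation. *)
Lemma card_cube_near_le (R : realType) (d : nat) (x : d.-tuple R) (eps : R) :
  (0 < d)%N -> unit_sphere d x -> 0 < eps < 1 ->
  (#|[set sigma | enorm (tsub x (cube_vertex R d sigma)) < eps]|)%:R *
    expR (d%:R * (1 - eps ^+ 2 / 2) ^+ 2 / 2) <= 2 ^+ d.
Proof.
move=> d0 x1 /andP[e0 e1]; set c := 1 - eps ^+ 2 / 2.
have d0R : 0 < d%:R :> R by rewrite ltr0n.
have sd0 : 0 < Num.sqrt (d%:R : R) by rewrite sqrtr_gt0.
have sdd : Num.sqrt (d%:R : R) ^+ 2 = d%:R by rewrite sqr_sqrtr// ler0n.
have c0 : 0 < c.
  rewrite subr_gt0 ltr_pdivrMr// mul1r; apply: lt_trans (_ : 1 < 2); last by lra.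
  by rewrite expr_lt1// ltW.
(* The parameter of the exponential moment that optimizes the bound. *)
pose lam : R := Num.sqrt d%:R * c.
pose X (sigma : {ffun 'I_d -> bool}) := \sum_i (-1) ^+ sigma i * tnth x i.
have near_X sigma : enorm (tsub x (cube_vertex R d sigma)) < eps ->
    expR (d%:R * c ^+ 2) <= expR (lam * X sigma).
  move=> xs; rewrite ler_expR /lam.
  have dotE : dotp x (cube_vertex R d sigma) = X sigma / Num.sqrt d%:R.
    rewrite /dotp /X mulr_suml; apply: eq_bigr => i _.
    by rewrite tnth_mktuple; ring.
  have cle : c <= X sigma / Num.sqrt d%:R.
    rewrite -dotE.
    have : enorm (tsub x (cube_vertex R d sigma)) ^+ 2 <= eps ^+ 2.
      by rewrite ler_sqr ?nnegrE ?sqrtr_ge0 ?(ltW e0)// ltW.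
    have -> : enorm (tsub x (cube_vertex R d sigma)) ^+ 2 =
        2 - 2 * dotp x (cube_vertex R d sigma).
      rewrite enormE rowt_tsub sqr_l2.
      transitivity (dotp x x + dotp (cube_vertex R d sigma) (cube_vertex R d sigma)
                    - 2 * dotp x (cube_vertex R d sigma)).
        rewrite /dotp mulr_sumr -big_split -sumrB /=; apply: eq_bigr => i _.
        by rewrite !mxE; ring.
      by rewrite !dotp_sphere//; exact: cube_vertex_unit.
    by rewrite /c; lra.
  move: cle; rewrite ler_pdivlMr// => cle.
  rewrite (_ : d%:R * c ^+ 2 = Num.sqrt d%:R * c * (c * Num.sqrt d%:R)).
    by rewrite ler_pM2l// mulr_gt0.
  by rewrite -{1}sdd; ring.
have mgf : \sum_sigma expR (lam * X sigma) <= 2 ^+ d * expR (lam ^+ 2 / 2).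
  have -> : \sum_sigma expR (lam * X sigma) =
      \prod_(i < d) (expR (lam * tnth x i) + expR (- (lam * tnth x i))).
    transitivity (\prod_(i < d) \sum_(b : bool)
      expR (lam * ((-1) ^+ b * tnth x i))).
      rewrite bigA_distr_bigA /=; apply: eq_bigr => sigma _.
      by rewrite -expR_sum /X mulr_sumr.
    apply: eq_bigr => i _; rewrite big_bool /= expr1 expr0 mul1r mulN1r mulrN.
    by rewrite addrC.
  apply: (@le_trans _ _ (\prod_(i < d) (2 * expR ((lam * tnth x i) ^+ 2 / 2)))).
    by apply: ler_prod => i _; rewrite addr_ge0 ?expR_ge0// cosh_le_gauss.
  rewrite big_split /= prodr_const card_ord -expR_sum -mulr_suml.
  rewrite (_ : \sum_i (lam * tnth x i) ^+ 2 = lam ^+ 2)//.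
  rewrite -[RHS]mulr1 -(dotp_sphere _ _ x1) /dotp mulr_sumr.
  by apply: eq_bigr => i _; ring.
have : #|[set sigma | enorm (tsub x (cube_vertex R d sigma)) < eps]|%:R *
    expR (d%:R * c ^+ 2) <= 2 ^+ d * expR (d%:R * c ^+ 2 / 2).
  have -> : d%:R * c ^+ 2 / 2 = lam ^+ 2 / 2 by rewrite /lam exprMn sdd.
  apply: le_trans mgf; rewrite -sum1_card natr_sum mulr_suml.
  rewrite [leRHS](bigID (fun sigma => sigma \in
     [set sigma | enorm (tsub x (cube_vertex R d sigma)) < eps])) /=.
  apply: ler_wpDr; first by apply: sumr_ge0 => s _; exact: expR_ge0.
  by apply: ler_sum => s; rewrite inE mul1r => /near_X.
rewrite [X in expR X](_ : _ = d%:R * c ^+ 2 / 2 + d%:R * c ^+ 2 / 2); last first.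
  by rewrite -splitr.
by rewrite expRD mulrA ler_pM2r ?expR_gt0.
Qed.

(** * Samples with few wrong labels *)

Section few_errors.
Context {R : realType} {d n : nat}.
Implicit Types (theta : d.-tuple R) (z : n.-tuple (d.-tuple R * bool)%type).

Definition num_errors theta z : nat :=
  #|[set i | (tnth z i).2 != (0 < dotp (tnth z i).1 theta)]|.

Definition few_errors theta (k : nat) : set (n.-tuple (d.-tuple R * bool)%type) :=
  [set z | num_errors theta z <= k]%classic%N.

Lemma num_errorsE theta z :
  (num_errors theta z)%:R = \sum_(i < n) \1_(mislabeled theta) (tnth z i) :> R.
Proof.
rewrite /num_errors -sum1_card natr_sum big_mkcond /=; apply: eq_bigr => i _.
rewrite indicE inE; case: ifPn => zi; first by rewrite mem_set.
by rewrite memNset//; exact/negP.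
Qed.

Let measurable_err theta i : measurable_fun setT
  (fun z : n.-tuple (d.-tuple R * bool)%type =>
    \1_(mislabeled theta) (tnth z i) : R).
Proof.
apply: (@measurableT_comp _ _ _ _ _ _ (\1_(mislabeled theta) : _ -> R)).
  by apply: measurable_indic; exact: measurable_mislabeled.
exact: measurable_tnth.
Qed.

Lemma measurable_num_errors theta :
  measurable_fun setT (fun z => (num_errors theta z)%:R : R).
Proof.
under eq_fun do rewrite num_errorsE.
by apply: measurable_sum => i.
Qed.

Lemma measurable_few_errors theta k : measurable (few_errors theta k).
Proof.
rewrite (_ : few_errors theta k =
    [set z | (num_errors theta z)%:R <= k%:R :> R]%classic).
  rewrite -[X in measurable X]setTI; apply: measurable_fun_le => //.
  exact: measurable_num_errors.
by apply/seteqP; split => z /=; rewrite /few_errors /= ler_nat.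
Qed.

Variable P : probability (d.-tuple R * bool)%type R.

Lemma iid_law_marginal (A : set (d.-tuple R * bool)) i : measurable A ->
  iid_law P n [set z | A (tnth z i)]%classic = P A.
Proof.
move=> mA; pose B j := if j == i then A else setT.
rewrite (_ : [set z | A (tnth z i)]%classic =
  [set t | forall j, B j (tnth t j)]%classic).
  rewrite iid_law_box; last by move=> j; rewrite /B; case: ifP.
  rewrite (bigD1 i)//= {1}/B eqxx big1 ?mule1// => j ji.
  by rewrite /B (negbTE ji); exact: probability_setT.
apply/seteqP; split => z /=; last by move/(_ i); rewrite /B eqxx.
by move=> Az j; rewrite /B; case: eqVneq => // ->.
Qed.

(** Markov's inequality: at most n * p errors are expected. *)
Lemma few_errors_compl_le theta (k : nat) (p a : R) :
  (P (mislabeled theta) <= p%:E)%E -> 0 < a -> a <= k.+1%:R ->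
  (iid_law P n (~` few_errors theta k)%classic <= (n%:R * p / a)%:E)%E.
Proof.
move=> Pp a0 ak; set C := (~` _)%classic.
have mC : measurable C by apply: measurableC; exact: measurable_few_errors.
have mM := measurable_mislabeled _ _ theta.
suff : (a%:E * iid_law P n C <= (n%:R * p)%:E)%E.
  have := fin_num_measure (iid_law P n) C mC; move/fineK => <-.
  by rewrite -EFinM !lee_fin ler_pdivlMr// mulrC.
rewrite -[C]setIT -integral_indic// -ge0_integralZl//; last 2 first.
- by apply/measurable_EFinP; exact: measurable_indic.
- by rewrite lee_fin ltW.
apply: (@le_trans _ _ (\int[iid_law P n]_z (\sum_(i < n)
    (\1_(mislabeled theta) (tnth z i))%:E))%E).
  apply: ge0_le_integral => //.
  - by move=> z _; rewrite mule_ge0// lee_fin ltW.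
  - apply: emeasurable_funM => //; apply/measurable_EFinP.
    exact: measurable_indic.
  - apply: emeasurable_sum => i; apply/measurable_EFinP.
    exact: measurable_err.
  move=> z _; rewrite sumEFin -num_errorsE -EFinM lee_fin indicE.
  have [zC|zC] := boolP (z \in C); last by rewrite mulr0.
  rewrite mulr1; apply: le_trans ak _; rewrite ler_nat.
  by move: zC; rewrite inE /C /few_errors /= => /negP; rewrite -ltnNge.
rewrite ge0_integral_sum//; last first.
  by move=> i; apply/measurable_EFinP; exact: measurable_err.
apply: (@le_trans _ _ (\sum_(i < n) p%:E)%E); last first.
  by rewrite sumEFin sumr_const card_ord mulr_natl.
apply: lee_sum => i _; apply: le_trans Pp; rewrite -(iid_law_marginal _ i)//.
rewrite -[X in (_ <= iid_law _ _ X)%E]setIT -integral_indic//; last first.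
  rewrite -[X in measurable X]setTI; exact: measurable_tnth.
Qed.

End few_errors.

(** * Counting the parameters that an estimator recovers *)

Section success.
Context {R : realType} {d n : nat}.
Variables (eps : R) (thetahat : n.-tuple (d.-tuple R * bool)%type -> d.-tuple R).
Hypothesis mthetahat : measurable_fun setT thetahat.

Definition success (theta : d.-tuple R) : set (n.-tuple (d.-tuple R * bool)%type) :=
  [set z | enorm (tsub (thetahat z) theta) < eps]%classic.

Lemma measurable_success theta : measurable (success theta).
Proof.
have mdist : measurable_fun setT (fun z => enorm (tsub (thetahat z) theta)).
  apply: (@measurableT_comp _ _ _ _ _ _ (Num.sqrt : R -> R)).
    by apply: continuous_measurable_fun; exact: sqrt_continuous.
  apply: measurable_sum => i.
  have mi : measurable_fun setT (fun z => tnth (tsub (thetahat z) theta) i).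
    under eq_fun do rewrite tnth_mktuple.
    apply: measurable_funB => //.
    exact: (measurableT_comp (measurable_tnth i) mthetahat).
  exact: measurable_funM.
rewrite -[success theta]setTI.
apply: (_ : measurable_fun _ _) measurableT [set true]%classic _ => //.
exact: measurable_fun_ltr.
Qed.

Variables (beta : \bar R) (I : finType) (theta : I -> d.-tuple R).

(** The counting argument.  Whatever the points, the pairs of a labeling and a
    parameter that is recovered from it with few errors number at most L * N:
    each of the [N] labelings that have few errors for some parameter determines
    an estimate, and an estimate is near at most [L] parameters. *)
Lemma success_counting (k L N : nat) (delta : R) :
  (forall i, (delta%:E <= data_law beta (theta i) n
     (success (theta i) `&` few_errors (theta i) k)%classic)%E) ->
  (forall z,
    (#|[set i | (enorm (tsub (thetahat z) (theta i)) < eps)%R]| <= L)%N) ->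
  (forall x : n.-tuple (d.-tuple R),
     #|[set y : n.-tuple bool |
         [exists i, num_errors (theta i) (attach x y) <= k]]|
       <= N)%N ->
  delta * #|I|%:R <= (L * N)%:R.
Proof.
move=> Pi cardL cardN.
pose E i := (success (theta i) `&` few_errors (theta i) k)%classic.
have mE i : measurable (E i).
  by apply: measurableI; [exact: measurable_success|exact: measurable_few_errors].
have := @sum_iid_law_le _ _ R I (fun i => logistic_law beta (theta i))
   (std_normal d) n E (L * N)
   (fun i A mA => logistic_law_le_labels _ _ beta (theta i) A mA) mE.
move=> sumE; rewrite -lee_fin; apply: le_trans (sumE _); last first.
  move=> x; move: (cardN x); set Y := [set y | _] => cardY.
  apply: leq_trans (_ : L * #|Y| <= _)%N; last by rewrite leq_mul2l cardY orbT.
  rewrite -sum1_card (eq_bigl (fun p : I * n.-tuple bool =>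
    `[< E p.1 (attach x p.2) >])); last by move=> p; rewrite inE.
  rewrite -(pair_big_dep xpredT (fun i y => `[< E i (attach x y) >])
     (fun _ _ => 1%N)) /= (exchange_big_dep xpredT) //=.
  rewrite (bigID (mem Y)) /= [X in (_ + X)%N]big1 ?addn0; last first.
    move=> y yY; rewrite big1// => i /asboolP[_ Ei]; move: yY.
    by rewrite inE => /existsP[]; exists i.
  rewrite mulnC -sum_nat_const; apply: leq_sum => y _.
  rewrite sum1_card; apply: leq_trans (cardL (attach x y)).
  apply: subset_leq_card; apply/fintype.subsetP => i.
  by rewrite inE => /asboolP[].
apply: (@le_trans _ _ (\sum_(i : I) delta%:E)%E);
  last by apply: lee_sum => i _; exact: Pi.
by rewrite sumEFin lee_fin sumr_const mulr_natr.
Qed.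

End success.

Section counting.
Context {R : realType} {m n : nat}.

(** With a positive first coordinate, the parameters lie in an affine slice of
    dimension [m], whence the sum of the first m + 1 binomial coefficients. *)
Lemma card_labelings_le (I : finType) (theta : I -> m.+1.-tuple R) (k : nat)
    (x : n.-tuple (m.+1.-tuple R)) :
  (forall i, 0 < tnth (theta i) ord0) ->
  (#|[set y : n.-tuple bool |
        [exists i, num_errors (theta i) (attach x y) <= k]]|
   <= (\sum_(j < m.+1) 'C(n, j)) * (\sum_(j < k.+1) 'C(n, j)))%N.
Proof.
move=> theta0.
pose signs i : n.-tuple bool := [tuple 0 < dotp (tnth x j) (theta i) | j < n].
pose S := [set signs i | i in I].
have cardS : (#|S| <= \sum_(j < m.+1) 'C(n, j))%N.
  suff : (#|S| <= \sum_(j < \rank (1%:M : 'M[R]_m.+1)) 'C(n, j))%N.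
    by rewrite mxrank1.
  apply: (@card_sign_patterns_le R m.+1 n (fun j => (rowt (tnth x j))^T)
    (delta_mx ord0 ord0)) => s /imsetP[i _ ->].
  exists (rowt (theta i)).
    by rewrite submx1 /= -colE !mxE.
  move=> j; rewrite tnth_mktuple mxE; congr (0 < _).
  by apply: eq_bigr => l _; rewrite !mxE mulrC.
apply: leq_trans (leq_mul cardS (leqnn _)).
apply: leq_trans (card_hamming_nbhd_le n k S); apply: subset_leq_card.
apply/fintype.subsetP => y; rewrite !inE => /existsP[i yi].
apply/exists_inP; exists (signs i); first exact: imset_f.
apply: leq_trans yi; rewrite /num_errors; apply: subset_leq_card.
by apply/fintype.subsetP => j; rewrite !inE !tnth_mktuple.
Qed.

Variables (eps : R)
  (thetahat : n.-tuple (m.+1.-tuple R * bool)%type -> m.+1.-tuple R).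
Hypothesis mthetahat : measurable_fun setT thetahat.
Hypothesis eps0 : 0 < eps.

(** The counting argument for a family of parameters that is 2 eps-separated, so
    that an estimate is near at most one of them.  The family is the lift of a
    packing of the ball of radius 3 / 5: with this radius the first coordinates
    stay above 4 / 5. *)
Lemma packing_counting (beta : \bar R) (k N : nat) (delta : R) : 0 <= delta ->
  (forall theta, unit_sphere m.+1 theta -> 4 / 5 <= tnth theta ord0 ->
    (delta%:E <= data_law beta theta n
       (success eps thetahat theta `&` few_errors theta k)%classic)%E) ->
  (forall (I : finType) (theta : I -> m.+1.-tuple R) x,
     (forall i, 0 < tnth (theta i) ord0) ->
     (#|[set y : n.-tuple bool |
        [exists i, num_errors (theta i) (attach x y) <= k]]|
        <= N)%N) ->
  delta * (3 / (10 * eps)) ^+ m <= N%:R.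
Proof.
move=> delta0 Pdelta cardN.
have [||s /andP[/allP sr sp] qs] := @exists_separated R m (3 / 5) (2 * eps).
- by rewrite divr_gt0.
- by rewrite mulr_gt0.
pose theta (i : 'I_(size s)) := lift_sphere (s`_i).
have sph i : unit_sphere m.+1 (theta i).
  apply: lift_sphere_unit; apply: le_trans (sr _ (mem_nth 0 (ltn_ord i))) _.
  by rewrite ler_pdivrMr// mul1r ler_nat.
have th0 i : 4 / 5 <= tnth (theta i) ord0.
  rewrite tnth0 -[leLHS]ger0_norm ?divr_ge0// -sqrtr_sqr ler_wsqrtr//.
  have := sr _ (mem_nth 0 (ltn_ord i)); set u := l2 _ => ur.
  have : u ^+ 2 <= (3 / 5) ^+ 2 by rewrite ler_sqr ?nnegrE ?l2_ge0// divr_ge0.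
  by lra.
have thp i : 0 < tnth (theta i) ord0.
  by apply: lt_le_trans (th0 i); rewrite divr_gt0.
have := @success_counting R m.+1 n eps thetahat mthetahat beta _ theta k 1 N delta.
rewrite card_ord mul1n => count.
apply: le_trans (count _ _ _).
- apply: ler_wpM2l => //; apply: le_trans qs.
  rewrite le_eqVlt; apply/orP; left; apply/eqP; congr (_ ^+ _).
  by field; rewrite gt_eqF.
- by move=> i; apply: Pdelta.
- move=> z; apply/card_le1_eqP => i j; rewrite !inE => zi zj.
  apply/eqP/negPn/negP => ij.
  have : 2 * eps <= l2 (s`_i - s`_j).
    have /pairwiseP-/(_ 0) sepP := sp.
    case: (ltngtP i j) => [lt_ij|lt_ji|/val_inj ijE];
      last by rewrite ijE eqxx in ij.
      exact: (sepP _ _ (ltn_ord i) (ltn_ord j) lt_ij).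
    by rewrite -l2N opprB; exact: (sepP _ _ (ltn_ord j) (ltn_ord i) lt_ji).
  apply/negP; rewrite -ltNge.
  apply: le_lt_trans (l2_sub_le_lift _ _ _) _.
  apply: le_lt_trans (enorm_tsub_le _ _ _ (thetahat z)) _.
  by rewrite mulr_natl mulr2n ltrD.
- by move=> x; apply: cardN.
Qed.

End counting.

(** * Lower bounds on the sample size *)

(** The threshold on [beta] is made for this: a label is wrong with probability
    at most (eps / 4) / (4 / 5), so that on average at most 5 / 16 of the
    [n * eps] errors that are tolerated do occur. *)
Lemma mislabeled_le (R : realType) (m : nat) (eps : R) (beta : \bar R)
    (theta : m.+1.-tuple R) :
  0 < eps -> (0 < beta)%E -> ((4 * Num.sqrt (2 / pi) / eps)%:E <= beta)%E ->
  4 / 5 <= tnth theta ord0 ->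
  (logistic_law beta theta (mislabeled theta) <= (5 / 16 * eps)%:E)%E.
Proof.
move=> eps0; case: beta => [b| |]//; last first.
  by move=> _ _ _; rewrite logistic_mislabeled_oo lee_fin mulr_ge0// ltW.
rewrite lte_fin lee_fin => b0 bK a45.
have a0 : 0 < tnth theta ord0 by apply: lt_le_trans a45; rewrite divr_gt0.
apply: le_trans (logistic_mislabeled_le _ _ _ _ b0 a0) _.
rewrite lee_fin ler_pdivrMr ?mulr_gt0//.
have K0 : 0 <= Num.sqrt (2 / pi : R) := sqrtr_ge0 _.
move: bK; rewrite ler_pdivrMr// => bK.
move: a45 bK K0; set a := tnth _ _; set K := Num.sqrt _ => a45 bK K0.
have := ler_pM (_ : 0 <= 4 / 5) (_ : 0 <= 4 * K) a45 bK.
have -> : (0 <= 4 / 5 :> R) by lra.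
rewrite mulr_ge0// => /(_ isT isT); lra.
Qed.

Section sample_bounds.
Context {R : realType} {m n : nat}.
Variables (eps : R) (beta : \bar R)
  (thetahat : n.-tuple (m.+1.-tuple R * bool)%type -> m.+1.-tuple R).
Hypothesis m0 : (0 < m)%N.
Hypothesis n0 : (0 < n)%N.
Hypothesis eps01 : 0 < eps < 1.
Hypothesis mthetahat : measurable_fun setT thetahat.
Hypothesis success_half : forall theta, unit_sphere m.+1 theta ->
  ((1 / 2)%:E <= data_law beta theta n (success eps thetahat theta))%E.

Let eps0 : 0 < eps. Proof. by case/andP: eps01. Qed.
Let mR0 : 0 < m%:R :> R. Proof. by rewrite ltr0n. Qed.
Let nR0 : 0 < n%:R :> R. Proof. by rewrite ltr0n. Qed.

Let few_errors_all theta :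
  few_errors theta n = setT :> set (n.-tuple (m.+1.-tuple R * bool)%type).
Proof.
apply/seteqP; split => // z _; rewrite /few_errors /= /num_errors.
by rewrite -[X in (_ <= X)%N](card_ord n) max_card.
Qed.

Let card_labels_all (I : finType) (theta : I -> m.+1.-tuple R) (k : nat)
    (x : n.-tuple (m.+1.-tuple R)) :
  (#|[set y : n.-tuple bool |
        [exists i, num_errors (theta i) (attach x y) <= k]]|
     <= 2 ^ n)%N.
Proof. by apply: leq_trans (max_card _) _; rewrite card_tuple card_bool. Qed.

Lemma success_few_errors_ge theta (k : nat) (p a : R) :
  unit_sphere m.+1 theta ->
  (logistic_law beta theta (mislabeled theta) <= p%:E)%E ->
  0 < a -> a <= k.+1%:R ->
  ((1 / 2 - n%:R * p / a)%:E <= data_law beta theta n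
     (success eps thetahat theta `&` few_errors theta k)%classic)%E.
Proof.
move=> sph Pp a0 ak.
have mS := measurable_success eps thetahat mthetahat theta.
have mF := @measurable_few_errors R m.+1 n theta k.
rewrite EFinB leeBlDr//; apply: le_trans (success_half _ sph) _.
rewrite /data_law.
apply: (@le_trans _ _ (iid_law (logistic_law beta theta) n
    ((success eps thetahat theta `&` few_errors theta k) `|`
     ~` few_errors theta k)%classic)).
  apply: le_measure; rewrite ?inE//.
  - by apply: measurableU; [exact: measurableI|exact: measurableC].
  - move=> z zS /=.
    by have [zF|zF] := pselect (few_errors theta k z); [left|right].
apply: le_trans (measureU2 _ _ _) _.
- exact: measurableI.
- exact: measurableC.
by apply: leeD => //; exact: few_errors_compl_le.
Qed.

(** There are only 2 ^ n labelings, and [eps] is small enough for the packing to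
    have more than 2 ^ m elements. *)
Lemma dimension_le_samples : eps < 3 / 20 -> (m <= n)%N.
Proof.
move=> eps_small; rewrite leqNgt; apply/negP => nm.
have : 1 / 2 * (3 / (10 * eps)) ^+ m <= (2 ^ n)%:R.
  apply: (packing_counting _ _ mthetahat eps0 beta n).
  - by rewrite divr_ge0.
  - by move=> theta /success_half + _; rewrite few_errors_all setIT.
  - by move=> I theta x _; exact: card_labels_all.
apply/negP; rewrite -ltNge natrX.
apply: le_lt_trans (_ : 1 / 2 * 2 ^+ m < _).
  rewrite mul1r mulrC ler_pdivlMr// -exprSr.
  by apply: ler_weXn2l => //; rewrite ler1n.
rewrite ltr_pM2l ?divr_gt0// ltrXn2r ?lt0n_neq0//.
by rewrite ltr_pdivlMr ?mulr_gt0//; lra.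
Qed.

Lemma sum_bin_dim_le : (m <= n)%N ->
  (\sum_(j < m.+1) 'C(n, j))%:R <= (expR 1 * n%:R / m%:R) ^+ m :> R.
Proof.
move=> mn.
have := @sum_bin_le_expR R n m (m%:R / n%:R).
rewrite divr_ge0// ler_pdivrMr// mul1r ler_nat => /(_ mn).
rewrite mulrCA mulfV ?gt_eqF// mulr1 => le_e.
rewrite (_ : expR 1 * n%:R / m%:R = expR 1 / (m%:R / n%:R)); last first.
  by field; rewrite !gt_eqF.
by rewrite expr_div_n ler_pdivlMr ?exprn_gt0 ?divr_gt0// -expRM_natr mul1r.
Qed.

(** The sphere has diameter 2, so that 2 eps-separated families are too small
    when [eps] is close to 1.  The vertices of the cube need not be separated: a
    ball of radius [eps] around a point of the sphere contains an exponentially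
    small proportion of them, to be compared with the 2 ^ n labelings. *)
Lemma samples_ge_of_large_eps : 3 / 20 <= eps ->
  (forall z, unit_sphere m.+1 (thetahat z)) ->
  m%:R / (8 * expR 1 * eps) <= n%:R.
Proof.
move=> eps_large sph; have /andP[_ eps1] := eps01.
pose near_z z :=
  [set sigma | enorm (tsub (thetahat z) (cube_vertex R m.+1 sigma)) < eps].
pose g := expR (m.+1%:R * (1 - eps ^+ 2 / 2) ^+ 2 / 2) : R.
have g0 : 0 < g := expR_gt0 _.
pose L := Num.truncn (2 ^+ m.+1 / g).
have cardL z : (#|near_z z| <= L)%N.
  rewrite /L truncn_ge_nat ?divr_ge0 ?exprn_ge0 ?(ltW g0)// ler_pdivlMr//.
  exact: card_cube_near_le.
have : 1 / 2 * #|{ffun 'I_m.+1 -> bool}|%:R <= (L * 2 ^ n)%:R :> R.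
  apply: (success_counting _ _ mthetahat beta _
    (fun sigma => cube_vertex R m.+1 sigma) n) => //.
  - move=> sigma; rewrite few_errors_all setIT; apply: success_half.
    exact: cube_vertex_unit.
  - exact: cardL.
rewrite card_ffun card_bool card_ord natrM !natrX => count.
have gn : g <= 2 ^+ n.+1.
  have LE : L%:R <= 2 ^+ m.+1 / g.
    by rewrite truncn_le divr_ge0 ?exprn_ge0 ?(ltW g0).
  have : 1 / 2 * 2 ^+ m.+1 <= 2 ^+ m.+1 / g * 2 ^+ n.
    by apply: le_trans count _; rewrite ler_pM2r ?exprn_gt0.
  rewrite mulrC -!mulrA ler_pM2l ?exprn_gt0// mul1r.
  by rewrite mulrC ler_pdivlMr// mulrC ler_pdivrMr// -exprSr.
(* The two numerical facts log 2 <= 3 / 4 and e >= 2.61. *)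
have e34 : 2 <= expR (3 / 4) :> R.
  rewrite (_ : 3 / 4 = 1 / 8 * 6%:R) ?expRM_natr; last by field.
  apply: (@le_trans _ _ ((9 / 8) ^+ 6)); first by lra.
  apply: lerXn2r; rewrite ?nnegrE ?expR_ge0//.
  by apply: le_trans (expR_ge1Dx _); lra.
have e26 : 261 / 100 <= expR 1 :> R.
  rewrite (_ : 1 = 1 / 16 * 16%:R) ?expRM_natr; last by field.
  apply: (@le_trans _ _ ((17 / 16) ^+ 16)); first by lra.
  apply: lerXn2r; rewrite ?nnegrE ?expR_ge0//.
  by apply: le_trans (expR_ge1Dx _); lra.
have : m.+1%:R * (1 - eps ^+ 2 / 2) ^+ 2 / 2 <= 3 / 4 * n.+1%:R.
  rewrite -ler_expR -/g expRM_natr; apply: le_trans gn _.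
  by apply: lerXn2r; rewrite ?nnegrE ?expR_ge0.
have f_eps : 144 / 1000 <= eps * (1 - eps ^+ 2 / 2) ^+ 2.
  have on_itv (l u v : R) : 0 <= l -> 0 <= v -> v <= 1 - u ^+ 2 / 2 ->
      144 / 1000 <= l * v ^+ 2 -> l <= eps <= u ->
      144 / 1000 <= eps * (1 - eps ^+ 2 / 2) ^+ 2.
    move=> l0 v0 vu lv /andP[le eu]; apply: le_trans lv _.
    have ev : v <= 1 - eps ^+ 2 / 2.
      apply: le_trans vu _; rewrite lerD2l lerN2 ler_pM2r ?invr_gt0//.
      by rewrite ler_sqr ?nnegrE ?(ltW eps0)// (le_trans _ eu)// ltW.
    by apply: ler_pM => //; rewrite ?sqr_ge0// lerXn2r ?nnegrE// (le_trans v0).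
  have [e2|e2] := leP eps (1 / 5).
    by apply: (on_itv (3 / 20) (1 / 5) (98 / 100)); lra.
  have [e3|e3] := leP eps (1 / 2).
    by apply: (on_itv (1 / 5) (1 / 2) (7 / 8)); lra.
  have [e4|e4] := leP eps (3 / 4).
    by apply: (on_itv (1 / 2) (3 / 4) (23 / 32)); lra.
  by apply: (on_itv (3 / 4) 1 (1 / 2)); lra.
set c2 := (1 - eps ^+ 2 / 2) ^+ 2 in f_eps *.
rewrite -[n.+1%:R]natr1 -[m.+1%:R]natr1 => mc.
rewrite ler_pdivrMr ?mulr_gt0 ?expR_gt0//.
have n1 : 1 <= n%:R :> R by rewrite ler1n.
have c20 : 0 <= c2 by exact: sqr_ge0.
have mc' : m%:R * c2 <= 3 * n%:R by nra.
have ee : 3 <= 8 * expR 1 * eps * c2 by nra.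
have c2p : 0 < c2 by nra.
rewrite -(ler_pM2r c2p); apply: le_trans mc' _.
by rewrite -[n%:R * _ * c2]mulrA (mulrC 3) ler_pM2l.
Qed.

(** Without noise there are no errors, so the packing has at most twice as many
    elements as there are sign patterns.  The factor 2 is absorbed in the basis
    of the power, as m >= 1. *)
Lemma samples_ge_noiseless : eps < 3 / 20 -> beta = +oo%E ->
  m%:R / (8 * expR 1 * eps) <= n%:R.
Proof.
move=> eps_small boo; have e0 := expR_gt0 (1 : R).
have mn := dimension_le_samples eps_small.
have : 1 / 2 * (3 / (10 * eps)) ^+ m <= (\sum_(j < m.+1) 'C(n, j))%:R :> R.
  apply: (packing_counting _ _ mthetahat eps0 beta 0).
  - by rewrite divr_ge0.
  - move=> theta sph _.
    have := @success_few_errors_ge theta 0 0 1 sph.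
    rewrite mulr0 mul0r subr0; apply=> //.
    by rewrite boo logistic_mislabeled_oo.
  - move=> I theta x theta0; apply: leq_trans (card_labelings_le _ _ _ _ theta0) _.
    by rewrite big_ord1 bin0 muln1.
move=> /le_trans-/(_ _ (sum_bin_dim_le mn)).
rewrite mul1r mulrC ler_pdivrMr// => le2.
have : (3 / (10 * eps)) ^+ m <= (2 * (expR 1 * n%:R / m%:R)) ^+ m.
  apply: le_trans le2 _; have : 0 <= expR 1 * n%:R / m%:R :> R.
    by rewrite divr_ge0// mulr_ge0// ltW.
  move: (expR 1 * n%:R / m%:R) => Y Y0.
  rewrite exprMn mulrC; apply: ler_wpM2r; first exact: exprn_ge0.
  by rewrite -[leLHS]expr1; apply: ler_weXn2l => //; rewrite ler1n.
have q0 : 0 <= 3 / (10 * eps) by rewrite divr_ge0// mulr_ge0// ltW.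
have Y0 : 0 <= 2 * (expR 1 * n%:R / m%:R) :> R.
  by rewrite mulr_ge0// divr_ge0// mulr_ge0// ltW.
rewrite ler_pXn2r ?nnegrE//.
rewrite ler_pdivrMr ?mulr_gt0// mulrA mulrAC ler_pdivlMr// => le3.
rewrite ler_pdivrMr ?mulr_gt0//.
have : 0 <= expR 1 * n%:R * eps :> R by rewrite !mulr_ge0// ltW.
nra.
Qed.

(** Tolerating [n * eps] errors multiplies the number of labelings by about
    (e / eps) ^ (n * eps).  With a = n eps / m all the bounds are powers of
    exponent [m], and taking roots leaves an inequality on [a] alone. *)
Lemma samples_ge_noisy : eps < 3 / 20 -> (0 < beta)%E ->
  ((4 * Num.sqrt (2 / pi) / eps)%:E <= beta)%E ->
  1 <= 160 / 9 * expR 1 * (n%:R * eps / m%:R) *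
       expR (n%:R * eps / m%:R * (1 - ln eps)).
Proof.
move=> eps_small beta0 betaK; set a := n%:R * eps / m%:R.
have e0 := expR_gt0 (1 : R).
have mn := dimension_le_samples eps_small.
have ne0 : 0 < n%:R * eps by rewrite mulr_gt0.
pose k := Num.truncn (n%:R * eps).
have kne : k%:R <= n%:R * eps by rewrite truncn_le ltW.
have N2 : (\sum_(j < k.+1) 'C(n, j))%:R <= expR (a * (1 - ln eps)) ^+ m.
  have epsk : expR (n%:R * eps * ln eps) <= eps ^+ k.
    rewrite -[in leRHS](@lnK _ eps) ?posrE// -expRM_natr ler_expR mulrC.
    rewrite ler_wnM2l// ln_le0//; by case/andP: eps01 => _ /ltW.
  have := @sum_bin_le_expR R n k eps.
  rewrite (ltW eps0); case/andP: (eps01) => _ /ltW -> /(_ isT) Ne.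
  rewrite -expRM_natr (_ : a * _ * m%:R = n%:R * eps - n%:R * eps * ln eps); last first.
    by rewrite /a; field; rewrite gt_eqF.
  rewrite expRD expRN ler_pdivlMr ?expR_gt0//.
  by apply: le_trans Ne; rewrite ler_wpM2l.
have : 3 / 16 * (3 / (10 * eps)) ^+ m <=
    ((\sum_(j < m.+1) 'C(n, j)) * (\sum_(j < k.+1) 'C(n, j)))%:R :> R.
  apply: (packing_counting _ _ mthetahat eps0 beta k).
  - by rewrite divr_ge0.
  - move=> theta sph theta0.
    have := @success_few_errors_ge theta k (5 / 16 * eps) (n%:R * eps) sph.
    rewrite (_ : 1 / 2 - _ = 3 / 16); last by field; rewrite !gt_eqF.
    apply => //; first exact: mislabeled_le.
    by rewrite ltW// truncnS_gt.
  - by move=> I theta x theta0; exact: card_labelings_le.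
rewrite natrM => count.
have {count} : 3 / 16 * (3 / (10 * eps)) ^+ m <=
    (expR 1 * n%:R / m%:R) ^+ m * expR (a * (1 - ln eps)) ^+ m.
  by apply: le_trans count _; apply: ler_pM => //; exact: sum_bin_dim_le.
rewrite -exprMn; set G := expR 1 * _ / _ * _.
have G0 : 0 < G by rewrite !mulr_gt0 ?expR_gt0// invr_gt0.
move=> count.
have : (3 / (10 * eps)) ^+ m <= (16 / 3 * G) ^+ m.
  rewrite [leRHS]exprMn; apply: (@le_trans _ _ (16 / 3 * G ^+ m)).
    by move: count; move: (_ ^+ m) (G ^+ m) => Q H; lra.
  rewrite ler_pM2r ?exprn_gt0// -[leLHS]expr1; apply: ler_weXn2l => //.
  by rewrite ler_pdivlMr// mul1r ler_nat.
have q0 : 0 <= 3 / (10 * eps) by rewrite divr_ge0// mulr_ge0// ltW.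
have G1 : 0 <= 16 / 3 * G by rewrite mulr_ge0// ltW.
rewrite ler_pXn2r ?nnegrE//.
rewrite ler_pdivrMr ?mulr_gt0// => le3.
rewrite (_ : 160 / 9 * expR 1 * a * _ = 16 / 3 * G * (10 * eps) / 3).
  by rewrite ler_pdivlMr// mul1r.
by rewrite /G /a; field; rewrite gt_eqF.
Qed.

End sample_bounds.

(** * The logarithmic rate *)

Section rate.
Context {R : realType}.
Implicit Types eps : R.

Definition loglog_gap eps : R := ln (ln (2 * expR 1 / eps)) - ln (16 * expR 1).

(** The value 0 that this takes when the gap is not positive, by the conventions
    on square roots and inverses, is as good as any: the bound is then void. *)
Definition rate_slack eps : R := 3 / Num.sqrt (loglog_gap eps).

Lemma rate_slack_ge0 eps : 0 <= rate_slack eps.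
Proof. by rewrite divr_ge0// sqrtr_ge0. Qed.

Lemma lt_loglog_gap eps (B : R) : 0 < eps ->
  eps < 2 * expR 1 / expR (16 * expR 1 * expR B) -> B < loglog_gap eps.
Proof.
move=> eps0; have e0 := expR_gt0 (1 : R); have eB := expR_gt0 B.
have E0 := expR_gt0 (16 * expR 1 * expR B).
rewrite ltr_pdivlMr// mulrC -ltr_pdivlMr// => lt_eps.
have lt_L : 16 * expR 1 * expR B < ln (2 * expR 1 / eps).
  by rewrite -ltr_expR lnK// posrE divr_gt0// mulr_gt0.
have e16 : 0 < 16 * expR 1 * expR B by rewrite !mulr_gt0.
rewrite ltrBrDr -[B](expRK) -lnM ?posrE ?mulr_gt0// mulrC ltr_ln ?posrE//.
exact: lt_trans lt_L.
Qed.

Lemma rate_slack_cvg0 :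
  (rate_slack x @[x --> 0^'+] --> (0 : R))%classic.
Proof.
apply/cvgrPdist_lt => e e0.
pose B := (3 / e) ^+ 2.
near=> x.
have x0 : 0 < x by near: x; exact: nbhs_right_gt.
have Bx : B < loglog_gap x.
  apply: lt_loglog_gap => //; near: x; apply: nbhs_right_lt.
have B0 : 0 <= B by exact: sqr_ge0.
have s0 : 0 < Num.sqrt (loglog_gap x) by rewrite sqrtr_gt0 (le_lt_trans B0).
rewrite sub0r normrN ger0_norm ?rate_slack_ge0// /rate_slack.
rewrite ltr_pdivrMr// mulrC -ltr_pdivrMr//.
rewrite -[ltLHS]ger0_norm; last by rewrite divr_ge0// ltW.
by rewrite -sqrtr_sqr ltr_sqrt// (le_lt_trans B0).
Unshelve. all: by end_near. Qed.

Lemma ln_le_sub1 (x : R) : 0 < x -> ln x <= x - 1.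
Proof.
by move=> x0; have := @le_ln1Dx R (x - 1); rewrite ltrBrDl subrr subrKC => /(_ x0).
Qed.

(** As b + ln b increases with [b], it suffices that its value at
    l / (1 + 3 / sqrt l) be less than l - 1 / 9.  With t = sqrt l
    and ln t <= t - 1, this holds as soon as 9 t ^ 2 - 37 t + 51 is positive, and
    its discriminant is negative. *)
Lemma gap_div_slack_le (l b : R) : 0 < l -> 0 < b ->
  l <= b + ln b + 1 / 9 -> l / (1 + 3 / Num.sqrt l) <= b.
Proof.
move=> l0 b0 lb; rewrite leNgt; apply/negP => bs.
set t := Num.sqrt l in bs.
have t0 : 0 < t by rewrite sqrtr_gt0.
have lt2 : l = t ^+ 2 by rewrite sqr_sqrtr// ltW.
have sE : l / (1 + 3 / t) = t ^+ 3 / (t + 3).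
  by rewrite lt2; field; rewrite !gt_eqF// addr_gt0.
rewrite sE in bs.
have bt : b < t ^+ 2.
  apply: lt_trans bs _; rewrite ltr_pdivrMr ?addr_gt0// exprSr.
  by rewrite ltr_pM2l ?exprn_gt0// ltrDl.
have lnb : ln b <= 2 * (t - 1).
  apply: (@le_trans _ _ (ln (t ^+ 2))); first by rewrite ler_ln ?posrE ?exprn_gt0// ltW.
  by rewrite lnXn// -[leLHS]mulr_natl ler_pM2l// ln_le_sub1.
have gapE : t ^+ 3 / (t + 3) + 2 * (t - 1) + 1 / 9 - l =
    (- 9 * t ^+ 2 + 37 * t - 51) / (9 * (t + 3)).
  by rewrite lt2; field; rewrite gt_eqF// addr_gt0.
have : (- 9 * t ^+ 2 + 37 * t - 51) / (9 * (t + 3)) < 0.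
  rewrite ltr_pdivrMr ?mul0r ?mulr_gt0 ?addr_gt0//.
  by have := sqr_ge0 (18 * t - 37); lra.
by rewrite -gapE; lra.
Qed.

End rate.

(** With b = a L, where L = ln (2 e / eps), the logarithm of the hypothesis says
    that b + ln b is at least the gap, up to ln (10 / 9) <= 1 / 9 which is the
    ratio between 160 / 9 and 16. *)
Lemma log_rate_le (R : realType) (m n : nat) (eps : R) :
  (0 < m)%N -> (0 < n)%N -> 0 < eps < 1 -> 0 < loglog_gap eps ->
  1 <= 160 / 9 * expR 1 * (n%:R * eps / m%:R) *
       expR (n%:R * eps / m%:R * (1 - ln eps)) ->
  m%:R / eps * (loglog_gap eps /
    ((1 + rate_slack eps) * ln (2 * expR 1 / eps))) <= n%:R.
Proof.
move=> m0 n0 /andP[eps0 eps1] gap0.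
have mR0 : 0 < m%:R :> R by rewrite ltr0n.
have nR0 : 0 < n%:R :> R by rewrite ltr0n.
have e0 := expR_gt0 (1 : R).
set a := n%:R * eps / m%:R => one_le.
have a0 : 0 < a by rewrite divr_gt0// mulr_gt0.
set L := ln (2 * expR 1 / eps).
have LE : L = ln 2 + 1 - ln eps.
  by rewrite /L ln_div ?posrE ?mulr_gt0// lnM ?posrE// expRK.
have ln2 : 0 < ln (2 : R) by rewrite ln_gt0// ltr1n.
have lneps : ln eps <= 0 by rewrite ln_le0// ltW.
have L0 : 0 < L by rewrite LE; lra.
have gapE : loglog_gap eps = ln L - ln 16 - 1.
  by rewrite /loglog_gap -/L lnM ?posrE// expRK opprD addrA.
have ln_ge0 : 0 <= ln (160 / 9 : R) + 1 + ln a + a * (1 - ln eps).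
  have c0 : 0 < 160 / 9 :> R by rewrite divr_gt0.
  move: one_le c0; move: (160 / 9) => c one_le c0.
  have E0 := expR_gt0 (a * (1 - ln eps)).
  have ce0 : 0 < c * expR 1 by exact: mulr_gt0.
  have cea0 : 0 < c * expR 1 * a by exact: mulr_gt0.
  have : ln 1 <= ln (c * expR 1 * a * expR (a * (1 - ln eps))).
    by rewrite ler_ln ?posrE ?ltr01// mulr_gt0.
  by rewrite ln1 (lnM cea0 E0) (lnM ce0 a0) (lnM c0 e0) !expRK.
have ln109 : ln (160 / 9 : R) <= ln 16 + 1 / 9.
  rewrite (_ : 160 / 9 = 16 * (1 + 1 / 9)); last by field.
  by rewrite lnM ?posrE ?addr_gt0 ?divr_gt0// lerD2l le_ln1Dx//; lra.
have b0 : 0 < a * L by exact: mulr_gt0.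
have lnb : ln (a * L) = ln a + ln L by rewrite lnM ?posrE.
have aL : a * (1 - ln eps) <= a * L by rewrite ler_pM2l// LE; lra.
have : loglog_gap eps / (1 + rate_slack eps) <= a * L.
  by apply: gap_div_slack_le => //; rewrite lnb gapE; lra.
have s1 : 0 < 1 + rate_slack eps by rewrite ltr_wpDr ?rate_slack_ge0.
rewrite /a; set G := _ / (1 + _) => GL.
have {}GL : G / L <= n%:R * eps / m%:R by rewrite ler_pdivrMr.
rewrite [leLHS](_ : _ = m%:R / eps * (G / L)); last first.
  by rewrite /G; field; rewrite !gt_eqF.
rewrite [leRHS](_ : _ = m%:R / eps * (n%:R * eps / m%:R)); last first.
  by field; rewrite !gt_eqF.
by rewrite ler_pM2l// divr_gt0.
Qed.

Local Open Scope classical_set_scope.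
Local Open Scope ring_scope.

Theorem theorem2 (R : realType) :
  exists r : R -> R,
    (forall eps : R, 0 < eps < 1 -> -1 < r eps) /\
    r x @[x --> 0^'+] --> (0 : R) /\
    forall (d n : nat) (eps : R) (beta : \bar R)
        (thetahat : n.-tuple (d.-tuple R * bool) -> d.-tuple R),
      (1 <= d)%N -> (1 <= n)%N -> 0 < eps < 1 ->
      (0 < beta)%E ->
      ((4 * Num.sqrt (2 / pi) / eps)%:E <= beta)%E ->
      measurable_fun [set: n.-tuple (d.-tuple R * bool)] thetahat ->
      (forall data, unit_sphere d (thetahat data)) ->
      (forall theta : d.-tuple R, unit_sphere d theta ->
        ((1 / 2)%:E <= data_law beta theta n
           [set data | (enorm (tsub (thetahat data) theta) < eps)%R])%E) ->
      (d%:R - 1) / eps *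
        ((ln (ln (2 * expR 1 / eps)) - ln (16 * expR 1)) /
         ((1 + r eps) * ln (2 * expR 1 / eps))) <= n%:R /\
      (beta = +oo%E -> (d%:R - 1) / (8 * expR 1 * eps) <= n%:R).
Proof.
exists rate_slack; split.
  by move=> eps _; apply: lt_le_trans (rate_slack_ge0 _); rewrite ltrN10.
split; first exact: rate_slack_cvg0.
case=> // m n eps beta thetahat _ n0 eps01 beta0 betaK mth sph half.
have /andP[eps0 eps1] := eps01.
rewrite -natr1 addrK; case: (posnP m) => [->|m0].
  by rewrite !mul0r; split => // _; exact: ler0n.
have e0 := expR_gt0 (1 : R).
split; last first.
  move=> boo; have [eps_small|eps_large] := ltP eps (3 / 20).
    exact: (samples_ge_noiseless _ beta thetahat).
  exact: (samples_ge_of_large_eps _ beta thetahat).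
have [gap0|gap0] := ltP 0 (loglog_gap eps); last first.
  apply: le_trans (ler0n _ _); apply: mulr_ge0_le0.
    by rewrite divr_ge0// ltW.
  apply: mulr_le0_ge0 => //; rewrite invr_ge0 mulr_ge0//.
    by rewrite addr_ge0// rate_slack_ge0.
  apply: ln_ge0; rewrite ler_pdivlMr// mul1r; apply: le_trans (ltW eps1) _.
  by apply: le_trans (_ : 2 * (1 + 1) <= _); [lra|rewrite ler_pM2l// expR_ge1Dx].
have eps_small : eps < 3 / 20.
  rewrite ltNge; apply/negP => eps_large.
  move: gap0; rewrite /loglog_gap subr_gt0; apply/negP; rewrite -leNgt.
  have le_arg : 2 * expR 1 / eps <= 16 * expR 1.
    rewrite ler_pdivrMr//.
    have : 0 <= expR 1 * (16 * eps - 2) by rewrite mulr_ge0 ?(ltW e0)//; lra.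
    by lra.
  have arg0 : 0 < 2 * expR 1 / eps by rewrite divr_gt0// mulr_gt0.
  have [L0|L0] := ltP 0 (ln (2 * expR 1 / eps)).
    rewrite ler_ln ?posrE ?mulr_gt0//; apply: le_trans le_arg.
    by apply: le_trans (ln_le_sub1 _ arg0) _; rewrite lerBlDr lerDl.
  rewrite (ln0 L0) ln_ge0//.
  have := expR_ge1Dx (1 : R); lra.
apply: log_rate_le => //.
exact: (samples_ge_noisy _ beta thetahat).
Qed.
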